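(* Let $\Omega$ be an open set in $\mathbb{C}^d$, let $\mathcal{H}$ be a Hilbert space, and let $\{u^k\}$ be a locally uniformly bounded sequence in $\mathrm{Hol}_{\mathcal{H}}(\Omega)$. Then there exists a sequence $\{U^k\}$ of unitary operators on $\mathcal{H}$ such that $\{U^k u^k\}$ has a subsequence that converges in $\mathrm{Hol}_{\mathcal{H}}(\Omega)$.
   Context: Hilbert spaces are complex. $\mathrm{Hol}_{\mathcal{H}}(\Omega)$ is the space of holomorphic $\mathcal{H}$-valued functions on $\Omega$, with the topology of uniform convergence (in the norm of $\mathcal{H}$) on compact subsets of $\Omega$. A sequence $\{u^k\}$ in $\mathrm{Hol}_{\mathcal{H}}(\Omega)$ is locally uniformly bounded on $\Omega$ if for each $\lambda\in\Omega$ there is a neighborhood $B\subseteq\Omega$ of $\lambda$ with $\sup_k\sup_{\mu\in B}\|u^k(\mu)\|_{\mathcal{H}}<\infty$. $U^k u^k$ denotes the function $\lambda\mapsto U^k(u^k(\lambda))$. *)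

(* Defs.v *)
From HB Require Import structures.
From mathcomp Require Import all_boot all_order all_algebra sesquilinear.
From mathcomp Require Import complex.
From mathcomp Require Import boolp classical_sets reals topology.
From mathcomp Require Import normedtype sequences derive.

Set Implicit Arguments.
Unset Strict Implicit.
Unset Printing Implicit Defensive.

Import Order.TTheory GRing.Theory Num.Theory.
Import numFieldNormedType.Exports.

Local Open Scope classical_set_scope.
Local Open Scope ring_scope.

(* [R[i]] with the topology of its modulus, transferred from the regular module
   [R[i]^o] as MathComp-Analysis does for the abstract number fields. *)
HB.instance Definition _ (R : realType) :=
  PseudoPointedMetric.copy R[i] R[i]^o.

(* [hdot] is linear in its first argument and conjugate-linear in the second
   one. *)
HB.mixin Record NormedModule_isHilbert (C : numClosedFieldType) H
    of NormedModule C H := {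
  hdot : {dot H for (@Num.conj C : C -> C)} ;
  hdot_norm : forall x : H, `|x| ^+ 2 = hdot x x
}.

#[short(type="hilbertType")]
HB.structure Definition Hilbert (C : numClosedFieldType) :=
  {H of CompleteNormedModule C H & NormedModule_isHilbert C H}.

Section HilbertValued.
Context {R : realType} {d : nat} {H : hilbertType R[i]}.
Implicit Types (Omega : set 'rV[R[i]]_d) (u g : 'rV[R[i]]_d -> H).

Definition unitary (U : {linear H -> H}) : Prop :=
  bijective U /\ isometry hdot hdot U.

(* An element of Hol_H(Omega) is encoded by a total function, the values of which
   outside of [Omega] are irrelevant. [differentiable] is Frechet
   differentiability over the field of scalars, here [R[i]]. *)
Definition holomorphic Omega u : Prop :=
  forall l, Omega l -> differentiable u l.

Definition locally_uniformly_bounded Omega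
    (u_ : nat -> 'rV[R[i]]_d -> H) : Prop :=
  forall l, Omega l -> exists B : set 'rV[R[i]]_d,
    [/\ nbhs l B, B `<=` Omega &
        exists M : R, forall k m, B m -> `|u_ k m| <= M%:C%C].

Definition cvg_in_Hol Omega (u_ : nat -> 'rV[R[i]]_d -> H) : Prop :=
  exists g, holomorphic Omega g /\ {family compactly_in Omega, u_ @ \oo --> g}.

End HilbertValued.

(* Main.v *)
From HB Require Import structures.
Require Import Defs.
From mathcomp Require Import all_boot all_order all_algebra.
From mathcomp Require Import complex sesquilinear ring lra.
From mathcomp Require Import boolp classical_sets functions reals topology.
From mathcomp Require Import normedtype sequences landau derive.

(* Gram-Schmidt: fix an orthonormal sequence (e_i) and a dense sequence (l_i) of
   points. Finitely many complex Householder reflections give a unitary U^k such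
   that U^k u^k(l_i) lies in the span of e_0, ..., e_i for all i < k. For fixed
   i, these vectors stay, from k = i + 1 on, in a bounded subset of a space of
   finite dimension, so a diagonal extraction yields a subsequence that converges
   at every l_i. The Cauchy estimates make the sequence locally equicontinuous,
   hence the convergence is locally uniform, and the second-order Taylor
   estimate, being uniform in k, passes to the limit and gives holomorphy.

   The Cauchy estimates come from Goursat's bisection argument applied to
   functions of one variable with values in a normed space. No integral is
   needed: Riemann sums over the boundary of a square with 2^n intervals per
   side are additive under bisection and vanish exactly on affine functions. *)

Set Implicit Arguments.
Unset Strict Implicit.
Unset Printing Implicit Defensive.

Import Order.TTheory GRing.Theory Num.Theory.
Import numFieldNormedType.Exports.

Local Open Scope classical_set_scope.
Local Open Scope ring_scope.
Local Open Scope complex_scope.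

Local Notation Re := complex.Re.
Local Notation Im := complex.Im.

(** * Linear identities in modules *)

(** Syntax for a reflexive procedure: [ring] handles scalars only, so a vector identity is first
    split into one scalar identity per atom. *)
Inductive modexpr (K : Type) : Type :=
  | MVar of nat | MZero | MAdd of modexpr K & modexpr K
  | MOpp of modexpr K | MScale of K & modexpr K.
Arguments MVar {K}.
Arguments MZero {K}.

Section ModExpr.
Context {K : comPzRingType} {V : lmodType K}.

Fixpoint mod_eval (env : seq V) (e : modexpr K) : V :=
  match e with
  | MVar i => nth 0 env i
  | MZero => 0
  | MAdd a b => mod_eval env a + mod_eval env b
  | MOpp a => - mod_eval env a
  | MScale k a => k *: mod_eval env a
  end.

(** Atoms are compared by [PeanoNat.Nat.eqb], which [cbn] evaluates on numerals. *)
Fixpoint mod_coef (e : modexpr K) (n : nat) : K :=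
  match e with
  | MVar i => if PeanoNat.Nat.eqb i n then 1 else 0
  | MZero => 0
  | MAdd a b => mod_coef a n + mod_coef b n
  | MOpp a => - mod_coef a n
  | MScale k a => k * mod_coef a n
  end.

Lemma mod_evalE env e :
  mod_eval env e = \sum_(i < size env) mod_coef e i *: nth 0 env i.
Proof.
elim: e => [i||a IHa b IHb|a IHa|k a IHa] /=.
- have [ltin|lein] := ltnP i (size env).
    rewrite (bigD1 (Ordinal ltin)) //= PeanoNat.Nat.eqb_refl scale1r.
    rewrite big1 ?addr0// => j /eqP neji.
    case: PeanoNat.Nat.eqb_spec => [eij|_]; last by rewrite scale0r.
    by case: neji; apply: val_inj.
  rewrite nth_default// big1// => j _.
  case: PeanoNat.Nat.eqb_spec => [eij|_]; last by rewrite scale0r.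
  by move: lein; rewrite eij leqNgt ltn_ord.
- by rewrite big1// => j _; rewrite scale0r.
- by rewrite IHa IHb -big_split; apply: eq_bigr => j _; rewrite scalerDl.
- by rewrite IHa -sumrN; apply: eq_bigr => j _; rewrite scaleNr.
- by rewrite IHa scaler_sumr; apply: eq_bigr => j _; rewrite scalerA.
Qed.

Fixpoint same_coefs (a b : modexpr K) (n : nat) : Prop :=
  match n with
  | 0 => True
  | n.+1 => mod_coef a n = mod_coef b n /\ same_coefs a b n
  end.

Lemma mod_eval_eq env a b :
  same_coefs a b (size env) -> mod_eval env a = mod_eval env b.
Proof.
rewrite !mod_evalE => eqab; apply: eq_bigr => i _; congr (_ *: _).
elim: (size env) i eqab => [[]//|n IHn] i /= [eqn eqab].
have := ltn_ord i; rewrite ltnS leq_eqVlt => /predU1P[->//|ltin].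
exact: (IHn (Ordinal ltin)).
Qed.

End ModExpr.

(* Atoms are identified up to conversion, because the same operation may come
   with different canonical structures. *)
Ltac mod_index x env :=
  match env with
  | cons ?y _ =>
    let _ := lazymatch goal with _ => unify x y end in constr:(0%N)
  | cons _ ?env' => let n := mod_index x env' in constr:(S n)
  end.
Ltac mod_snoc x env :=
  match env with
  | nil => constr:([:: x])
  | cons ?y _ =>
    let _ := lazymatch goal with _ => unify x y end in constr:(env)
  | cons ?y ?env' => let r := mod_snoc x env' in constr:(cons y r)
  end.
Ltac mod_env e env :=
  lazymatch e with
  | (?a + ?b)%R => let env := mod_env a env in mod_env b env
  | (- ?a)%R => mod_env a env
  | (_ *: ?a)%R => mod_env a env
  | (0)%R => constr:(env)
  | _ => mod_snoc e env
  end.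
Ltac mod_quote K e env :=
  lazymatch e with
  | (?a + ?b)%R => let a := mod_quote K a env in
      let b := mod_quote K b env in constr:(@MAdd K a b)
  | (- ?a)%R => let a := mod_quote K a env in constr:(@MOpp K a)
  | (?k *: ?a)%R => let a := mod_quote K a env in constr:(@MScale K k a)
  | (0)%R => constr:(@MZero K)
  | _ => let i := mod_index e env in constr:(@MVar K i)
  end.
(* Reduces an equality of linear combinations over the scalars [K] to the
   equality of the coefficients of each atom. *)
Ltac module_coefs K :=
  lazymatch goal with
  | |- @eq ?V ?a ?b =>
    let env := mod_env a (@nil V) in
    let env := mod_env b env in
    let qa := mod_quote K a env in
    let qb := mod_quote K b env in
    apply: (@mod_eval_eq _ _ env qa qb);
    cbn [same_coefs mod_coef size PeanoNat.Nat.eqb]; repeat split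
  end.
Ltac module_ring K := module_coefs K; ring.

(** * Real-valued norms and Riemann sums on squares *)

Section RealNorm.
Context {R : realType}.
Implicit Types V : normedZmodType R[i].

(** Norms take values in [R[i]], which is only partially ordered; the real version lives in [R],
    where [lra] and [nra] apply. *)
Definition nr V (x : V) : R := Re `|x|.

Lemma nrE V (x : V) : `|x| = (nr x)%:C.
Proof. by rewrite /nr RRe_real// ger0_real. Qed.

Lemma nr_ge0 V (x : V) : 0 <= nr x.
Proof. by rewrite -ler0c -nrE. Qed.

Lemma nr0 V : nr (0 : V) = 0.
Proof. by rewrite /nr normr0. Qed.

Lemma nrN V (x : V) : nr (- x) = nr x.
Proof. by rewrite /nr normrN. Qed.

Lemma nrD V (x y : V) : nr (x + y) <= nr x + nr y.
Proof. by rewrite -lecR rmorphD/= -!nrE ler_normD. Qed.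

Lemma nrB V (x y : V) : nr (x - y) <= nr x + nr y.
Proof. by rewrite -(nrN y) nrD. Qed.

Lemma nr_distC V (x y : V) : nr (x - y) = nr (y - x).
Proof. by rewrite -nrN opprB. Qed.

Lemma nr_dist V (y x z : V) : nr (x - z) <= nr (x - y) + nr (y - z).
Proof. by rewrite (le_trans _ (nrD _ _))// addrA subrK. Qed.

Lemma nr_lerB V (x y : V) : nr x - nr y <= nr (x - y).
Proof. by rewrite lerBlDr -{1}(subrK y x) nrD. Qed.

Lemma nr_eq0 V (x : V) : (nr x == 0) = (x == 0).
Proof. by rewrite -[RHS]normr_eq0 nrE -(inj_eq (@complexI R)). Qed.

Lemma nr_gt0 V (x : V) : (0 < nr x) = (x != 0).
Proof. by rewrite lt_def nr_ge0 andbT nr_eq0. Qed.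

Lemma nr_sum V n (F : 'I_n -> V) : nr (\sum_(j < n) F j) <= \sum_(j < n) nr (F j).
Proof.
elim/big_ind2 : _ => [|x a y b xa yb|//]; first by rewrite nr0.
by rewrite (le_trans (nrD _ _))// lerD.
Qed.

Lemma nrM (a b : R[i]) : nr (a * b) = nr a * nr b.
Proof. by apply: complexI; rewrite rmorphM/= -!nrE normrM. Qed.

Lemma nrZ (V : normedModType R[i]) a (x : V) : nr (a *: x) = nr a * nr x.
Proof. by apply: complexI; rewrite rmorphM/= -!nrE normrZ. Qed.

Lemma nrV (a : R[i]) : nr a^-1 = (nr a)^-1.
Proof. by apply: complexI; rewrite fmorphV/= -!nrE normfV. Qed.

Lemma nr_real (x : R) : nr x%:C = `|x|.
Proof. by rewrite /nr normc_def/= expr0n addr0 sqrtr_sqr. Qed.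

Lemma nri : nr ('i : R[i]) = 1.
Proof. by rewrite /nr normc_def/= expr0n add0r expr1n sqrtr1. Qed.

Lemma nr_sqr (a : R[i]) : nr a ^+ 2 = Re a ^+ 2 + Im a ^+ 2.
Proof.
apply: complexI; rewrite add_Re2_Im2 nrE.
by rewrite rmorphXn.
Qed.

Lemma Re_le_nr (a : R[i]) : `|Re a| <= nr a.
Proof.
rewrite -(@ler_pXn2r _ 2) ?nnegrE ?nr_ge0//.
by rewrite nr_sqr real_normK ?num_real// lerDl sqr_ge0.
Qed.

Lemma Im_le_nr (a : R[i]) : `|Im a| <= nr a.
Proof.
rewrite -(@ler_pXn2r _ 2) ?nnegrE ?nr_ge0//.
by rewrite nr_sqr real_normK ?num_real// lerDr sqr_ge0.
Qed.

Lemma nr_le_ReIm (a : R[i]) : nr a <= `|Re a| + `|Im a|.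
Proof.
rewrite -(@ler_pXn2r _ 2) ?nnegrE ?nr_ge0 ?addr_ge0//.
rewrite nr_sqr sqrrD !real_normK ?num_real//.
by rewrite lerD2r lerDl mulrn_wge0// mulr_ge0.
Qed.

End RealNorm.

(** * Riemann sums along the boundary of a square *)

Section SquareSums.
Context {R : realType} {V : normedModType R[i]}.
Implicit Types (f g : R[i] -> V) (x y s h : R).

Definition square x y s (z : R[i]) : bool :=
  [&& x <= Re z, Re z <= x + s, y <= Im z & Im z <= y + s].

Definition square_boundary x y s (z : R[i]) : bool :=
  square x y s z &&
    [|| Re z == x, Re z == x + s, Im z == y | Im z == y + s].

Definition hsum f n h x y : V := \sum_(j < n) f ((x + j%:R * h) +i* y).
Definition vsum f n h x y : V := \sum_(j < n) f (x +i* (y + j%:R * h)).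

(* Left-endpoint Riemann sum of the contour integral along the boundary of the
   square with lower left corner [x +i* y] and side [s]. *)
Definition bsum f x y s n : V :=
  let h := s / (2 ^ n)%:R in
  h%:C *: (hsum f (2 ^ n) h x y - hsum f (2 ^ n) h x (y + s)
           + 'i *: (vsum f (2 ^ n) h (x + s) y - vsum f (2 ^ n) h x y)).

Lemma hsumD f m n h x y :
  hsum f (m + n) h x y = hsum f m h x y + hsum f n h (x + m%:R * h) y.
Proof.
rewrite /hsum big_split_ord/=; congr (_ + _); apply: eq_bigr => j _.
by rewrite natrD mulrDl addrA.
Qed.

Lemma vsumD f m n h x y :
  vsum f (m + n) h x y = vsum f m h x y + vsum f n h x (y + m%:R * h).
Proof.
rewrite /vsum big_split_ord/=; congr (_ + _); apply: eq_bigr => j _.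
by rewrite natrD mulrDl addrA.
Qed.

Lemma natr2X_neq0 n : (2 ^ n)%:R != 0 :> R.
Proof. by rewrite pnatr_eq0 expn_eq0. Qed.

(** The quarters at level [n] have the same mesh as the whole at level [n.+1], and the sums over
    inner edges cancel in pairs. *)
Lemma bsumS f x y s n : bsum f x y s n.+1 =
  bsum f x y (s / 2) n + bsum f (x + s / 2) y (s / 2) n +
  bsum f x (y + s / 2) (s / 2) n + bsum f (x + s / 2) (y + s / 2) (s / 2) n.
Proof.
rewrite /bsum; set h := s / 2 / _.
have -> : s / (2 ^ n.+1)%:R = h.
  by rewrite expnS natrM invfM mulrA.
have hE : (2 ^ n)%:R * h = s / 2 by rewrite /h mulrC divfK// natr2X_neq0.
rewrite expnS mul2n -addnn !hsumD !vsumD !hE.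
have sE (u : R) : u + s / 2 + s / 2 = u + s by rewrite -addrA -splitr.
rewrite !sE; by module_ring R[i].
Qed.

Lemma bsumB f g x y s n :
  bsum (fun z => f z - g z) x y s n = bsum f x y s n - bsum g x y s n.
Proof.
rewrite /bsum /hsum /vsum !sumrB; by module_ring R[i].
Qed.

(** Nodes on opposite sides differ by a fixed translation, so each index contributes
    [(- 'i * s + 'i * s) *: b = 0]; the cancellation is exact at every [n]. *)
Lemma bsum_affine (a b : V) x y s n : bsum (fun z => a + z *: b) x y s n = 0.
Proof.
rewrite /bsum /hsum /vsum -!sumrB scaler_sumr -big_split/= big1 ?scaler0// => j _.
have E (u v : R) : u +i* v = u%:C + 'i * v%:C by rewrite [LHS]complexE.
by rewrite !E !rmorphD/=; module_coefs R[i]; ring: (sqr_i R).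
Qed.

Lemma bsumE f x y s n (h := s / (2 ^ n)%:R) :
  bsum f x y s n = h%:C *: \sum_(j < 2 ^ n)
    (f ((x + j%:R * h) +i* y) - f ((x + j%:R * h) +i* (y + s)) +
     'i *: (f ((x + s) +i* (y + j%:R * h)) - f (x +i* (y + j%:R * h)))).
Proof. by rewrite /bsum /hsum /vsum -!sumrB scaler_sumr -big_split. Qed.

Lemma square_boundary_grid x y s n (h := s / (2 ^ n)%:R) (j : 'I_(2 ^ n)) :
  0 <= s ->
  [/\ square_boundary x y s ((x + j%:R * h) +i* y),
     square_boundary x y s ((x + j%:R * h) +i* (y + s)),
     square_boundary x y s ((x + s) +i* (y + j%:R * h)) &
     square_boundary x y s (x +i* (y + j%:R * h))].
Proof.
move=> s0; have h0 : 0 <= h by rewrite divr_ge0.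
have jh0 : 0 <= j%:R * h by rewrite mulr_ge0.
have jhs : j%:R * h <= s.
  rewrite -[leRHS](divfK (natr2X_neq0 n)) -/h mulrC.
  by rewrite ler_wpM2l// ler_nat ltnW.
by split; rewrite /square_boundary /square/= !lerDl !lerD2l ?jh0 ?jhs ?s0
  ?lexx ?eqxx ?orbT.
Qed.

Lemma eq_bsum f g x y s n : 0 <= s ->
  (forall z, square_boundary x y s z -> f z = g z) ->
  bsum f x y s n = bsum g x y s n.
Proof.
move=> s0 fg; rewrite !bsumE; congr (_ *: _); apply: eq_bigr => j _.
by have [? ? ? ?] := square_boundary_grid x y j s0; rewrite !fg.
Qed.

Lemma nr_bsum_le f x y s n B : 0 <= s ->
  (forall z, square_boundary x y s z -> nr (f z) <= B) ->
  nr (bsum f x y s n) <= 4 * s * B.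
Proof.
move=> s0 fB; rewrite bsumE nrZ nr_real ger0_norm; last by rewrite divr_ge0.
set h := s / _.
have -> : 4 * s * B = h * \sum_(j < 2 ^ n) (4 * B).
  rewrite sumr_const card_ord -[in RHS]mulr_natr /h.
  by field; rewrite natr2X_neq0.
rewrite ler_wpM2l ?divr_ge0// (le_trans (nr_sum _))//; apply: ler_sum => j _.
have [/fB b1 /fB b2 /fB b3 /fB b4] := square_boundary_grid x y j s0.
rewrite (le_trans (nrD _ _))// nrZ nri mul1r.
by have := nrB (f ((x + j%:R * h) +i* y)) (f ((x + j%:R * h) +i* (y + s)));
  have := nrB (f ((x + s) +i* (y + j%:R * h))) (f (x +i* (y + j%:R * h)));
  rewrite -/h in b1 b2 b3 b4 *; lra.
Qed.

End SquareSums.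

(** * Goursat's lemma and Cauchy estimates *)

Section Goursat.
Context {R : realType} {V : normedModType R[i]}.
Implicit Types (f : R[i] -> V) (x y s e : R) (z w p q : R[i]).

Definition is_cderive f z (l : V) : Prop :=
  forall e, 0 < e -> exists2 d : R, 0 < d &
    forall w, nr (w - z) < d -> nr (f w - f z - (w - z) *: l) <= e * nr (w - z).

Definition cderivable f z : Prop := exists l, is_cderive f z l.

(* Counts [p] once or twice if it lies in the closed interval, in such a way
   that the counting is additive with respect to bisection. *)
Definition hits (p x s : R) : R := (x <= p < x + s)%R%:R + (x < p <= x + s)%R%:R.

Lemma hits_ge0 (p x s : R) : 0 <= hits p x s.
Proof. by rewrite addr_ge0. Qed.

Lemma hits_ge1 (p x s : R) : 0 < s -> x <= p <= x + s -> 1 <= hits p x s.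
Proof.
move=> s0 /andP[xp ps]; rewrite /hits xp ps andbT/= [x < p]lt_def xp andbT.
have [->|_] := eqVneq p x; last by rewrite lerDr.
by rewrite ltrDl s0 addr0.
Qed.

Lemma hitsD (p x s t : R) : 0 < s -> 0 < t ->
  hits p x (s + t) = hits p x s + hits p (x + s) t.
Proof.
move=> s0 t0; rewrite /hits addrA.
have [] := ltrP p x; have [] := ltrP x p; have [] := ltrP p (x + s);
  have [] := ltrP (x + s) p; have [] := ltrP p (x + s + t);
  have [] := ltrP (x + s + t) p => * /=; lra.
Qed.

(** A mass at [p], additive under bisection as the area is, and at least 1 on closed squares
    containing [p]. Added to the area, it lets the bisection argument pass through points where only
    boundedness is known. *)
Definition weight p x y s : R := hits (Re p) x s * hits (Im p) y s.

Lemma weight_ge0 p x y s : 0 <= weight p x y s.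
Proof. by rewrite mulr_ge0 ?hits_ge0. Qed.

Lemma weight_ge1 p x y s : 0 < s -> square x y s p -> 1 <= weight p x y s.
Proof.
move=> s0 /and4P[? ? ? ?].
by rewrite -[leLHS]mulr1 ler_pM ?hits_ge1//; apply/andP.
Qed.

Lemma weight_split p x y s : 0 < s -> weight p x y s =
  weight p x y (s / 2) + weight p (x + s / 2) y (s / 2) +
  weight p x (y + s / 2) (s / 2) + weight p (x + s / 2) (y + s / 2) (s / 2).
Proof.
move=> s0; have s2 : 0 < s / 2 by rewrite divr_gt0.
by rewrite /weight {1 2}(splitr s) !hitsD//; ring.
Qed.

Definition subsquare (t' t : R * R * R) : Prop :=
  [/\ t'.2 = t.2 / 2, t.1.1 <= t'.1.1, t.1.2 <= t'.1.2,
      t'.1.1 + t'.2 <= t.1.1 + t.2 & t'.1.2 + t'.2 <= t.1.2 + t.2].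

Lemma half_pow_lt (s e : R) : 0 < e -> exists n, s / (2 ^ n)%:R < e.
Proof.
move=> e0; have [n sn] : exists n, s / e < n%:R.
  by exists (Num.bound `|s / e|); rewrite (le_lt_trans (ler_norm _))// archi_boundP.
exists n; rewrite ltr_pdivrMr ?ltr0n ?expn_gt0// mulrC -ltr_pdivrMr//.
by rewrite (lt_trans sn)// ltr_nat ltn_expl.
Qed.

Lemma nested_squares (T : nat -> R * R * R) : 0 <= (T 0).2 ->
  (forall n, subsquare (T n.+1) (T n)) ->
  exists p, forall n, square (T n).1.1 (T n).1.2 (T n).2 p.
Proof.
move=> T0 sub.
have Ts n : 0 <= (T n).2.
  by elim: n => // n IHn; have [-> _ _ _ _] := sub n; rewrite divr_ge0.
have mon m n : (m <= n)%N -> [/\ (T m).1.1 <= (T n).1.1, (T m).1.2 <= (T n).1.2,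
    (T n).1.1 + (T n).2 <= (T m).1.1 + (T m).2 &
    (T n).1.2 + (T n).2 <= (T m).1.2 + (T m).2].
  elim: n => [|n IHn]; first by rewrite leqn0 => /eqP ->.
  rewrite leq_eqVlt => /predU1P[->//|/IHn[? ? ? ?]].
  by have [_ ? ? ? ?] := sub n; split; lra.
(* One coordinate at a time: the supremum of the lower ends lies in all the intervals. *)
have main (a : R * R * R -> R) :
    (forall m n, (m <= n)%N -> a (T m) <= a (T n) /\
       a (T n) + (T n).2 <= a (T m) + (T m).2) ->
    exists u, forall n, a (T n) <= u <= a (T n) + (T n).2.
  move=> amon; pose A := [set a (T n) | n in setT]%classic.
  have ub n : ubound A (a (T n) + (T n).2).
    move=> _ [m _ <-]; have [mn|/ltnW nm] := leqP m n.
      by have [? _] := amon _ _ mn; have := Ts n; lra.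
    by have [_ ?] := amon _ _ nm; have := Ts m; lra.
  exists (sup A) => n; apply/andP; split.
    by apply: ub_le_sup; [exists (a (T 0) + (T 0).2); exact: ub|exists n].
  by apply: ge_sup; [exists (a (T 0)); exists 0%N|exact: ub].
have [u uT] : exists u, forall n, (T n).1.1 <= u <= (T n).1.1 + (T n).2.
  by apply: (main (fun t => t.1.1)) => m n /mon[].
have [v vT] : exists u, forall n, (T n).1.2 <= u <= (T n).1.2 + (T n).2.
  by apply: (main (fun t => t.1.2)) => m n /mon[].
exists (u +i* v) => n; rewrite /square/=.
by have /andP[-> ->] := uT n; have /andP[-> ->] := vT n.
Qed.

Lemma square_dist x y s z w : square x y s z -> square x y s w ->
  nr (z - w) <= 2 * s.
Proof.
case: z w => [a b] [c d] /and4P[/= ? ? ? ?] /and4P[/= ? ? ? ?].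
rewrite (le_trans (nr_le_ReIm _))//= mulr_natl mulr2n.
by rewrite lerD// ler_norml; apply/andP; split; lra.
Qed.

(** The affine approximation at [z] has zero boundary sum; the remainder is at most [e * (2 * s)] on
    a contour of length [4 * s]. *)
Lemma goursat_local f x y s e z l : 0 < s -> square x y s z ->
  (forall w, square x y s w -> nr (f w - f z - (w - z) *: l) <= e * nr (w - z)) ->
  0 <= e -> forall n, nr (bsum f x y s n) <= 8 * e * s ^+ 2.
Proof.
move=> s0 zs fl e0 n.
pose g w := (f z - z *: l) + w *: l.
have -> : bsum f x y s n = bsum (fun w => f w - g w) x y s n.
  by rewrite bsumB bsum_affine subr0.
have -> : 8 * e * s ^+ 2 = 4 * s * (e * (2 * s)) by ring.
apply: nr_bsum_le => [|w /andP[ws _]]; first exact: ltW.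
have -> : f w - g w = f w - f z - (w - z) *: l by rewrite /g; module_ring R[i].
by rewrite (le_trans (fl _ ws))// ler_wpM2l// (square_dist ws zs).
Qed.

(** A square is [good] if its boundary sums are eventually at most [e * tot], where [tot] adds to
    the area the weights of the exceptional points [p] and [q]. As [tot] is additive, a bad square
    has a bad quarter; the bad squares shrink to a point near which the bound does hold. *)
Theorem goursat f x y s B p q : 0 < s ->
  (forall z, square x y s z -> nr (f z) <= B) ->
  (forall z, square x y s z -> z != p -> z != q -> cderivable f z) ->
  forall e, 0 < e ->
  exists N, forall n, (N <= n)%N -> nr (bsum f x y s n) <= e.
Proof.
move=> s0 fB fd.
pose tot (t : R * R * R) := t.2 ^+ 2 + weight p t.1.1 t.1.2 t.2
                                + weight q t.1.1 t.1.2 t.2.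
pose good e (t : R * R * R) := exists N, forall n, (N <= n)%N ->
  nr (bsum f t.1.1 t.1.2 t.2 n) <= e * tot t.
suff main e : 0 < e -> good e (x, y, s).
  move=> e e0; have t0 : 0 < tot (x, y, s).
    by rewrite !ltr_wpDr ?weight_ge0// exprn_gt0.
  have [N HN] := main _ (divr_gt0 e0 t0).
  by exists N => n /HN /=; rewrite divfK// gt_eqF.
move=> e0; apply: contrapT => bad0.
(* The premises stand under the existential, with [t] itself as default, so that [choice] yields a
   total function [next]. *)
have step t : exists t', ~ good e t -> 0 < t.2 -> ~ good e t' /\ subsquare t' t.
  case: t => [[a b] r]; have [gt|bt] := pselect (good e (a, b, r)).
    by exists (a, b, r).
  have [r0|] := boolP (0 < r); last by exists (a, b, r).
  have r2 : 0 < r / 2 by rewrite divr_gt0.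
  apply: contrapT => /forallNP nex; apply: bt.
  have sub t' : subsquare t' (a, b, r) -> good e t'.
    by move=> st; apply: contrapT => nt; apply: (nex t').
  have [N1 H1] : good e (a, b, r / 2) by apply: sub; split=> /=; lra.
  have [N2 H2] : good e (a + r / 2, b, r / 2) by apply: sub; split=> /=; lra.
  have [N3 H3] : good e (a, b + r / 2, r / 2) by apply: sub; split=> /=; lra.
  have [N4 H4] : good e (a + r / 2, b + r / 2, r / 2)
    by apply: sub; split=> /=; lra.
  (* The successor is there because level [n.+1] of the square is level [n] of its quarters. *)
  exists (maxn (maxn N1 N2) (maxn N3 N4)).+1 => -[//|n].
  rewrite ltnS !geq_max => /andP[/andP[/H1 /= + /H2 /= +] /andP[/H3 /= + /H4 /= +]].
  rewrite bsumS /tot/= !(weight_split _ _ _ r0).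
  set u1 := bsum _ _ _ _ _; set u2 := bsum _ _ _ _ _.
  set u3 := bsum _ _ _ _ _; set u4 := bsum _ _ _ _ _.
  have := nrD (u1 + u2 + u3) u4; have := nrD (u1 + u2) u3; have := nrD u1 u2.
  nra.
have [next nextP] := choice step.
pose T n := iter n next (x, y, s).
have TP n : [/\ ~ good e (T n), 0 < (T n).2 & subsquare (T n.+1) (T n)].
  elim: n => [|n [bn sn stn]].
    by have [? ?] := nextP _ bad0 s0.
  have [bn' _] := nextP _ bn sn.
  have sn' : 0 < (T n.+1).2 by have [-> _ _ _ _] := stn; rewrite divr_gt0.
  by split => //; have [] := nextP _ bn' sn'.
have [//||z zT] := @nested_squares T; first exact: ltW.
  by move=> n; have [] := TP n.
have Ts n : (T n).2 = s / (2 ^ n)%:R.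
  elim: n => [|n IHn]; first by rewrite expn0 divr1.
  by have [_ _ [-> _ _ _ _]] := TP n; rewrite IHn expnSr natrM invfM mulrA.
have Tsub n w : square (T n).1.1 (T n).1.2 (T n).2 w -> square x y s w.
  elim: n => [//|n IHn] /and4P[? ? ? ?]; apply: IHn.
  by have [_ _ [_ ? ? ? ?]] := TP n; apply/and4P; split; lra.
(* Exceptional limit point: [tot] is at least 1, whereas the sum is at most [4 * B] times a side
   tending to 0. *)
have [zpq|zpq] := boolP ((z == p) || (z == q)).
  have B0 : 0 <= B by rewrite (le_trans (nr_ge0 _) (fB _ (Tsub 0%N _ (zT 0%N)))).
  have [n sn] : exists n, s / (2 ^ n)%:R < e / (4 * B + 1).
    by apply: half_pow_lt; rewrite divr_gt0// ltr_wpDl// mulr_ge0.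
  have [+ sn0 _] := TP n; apply; exists 0%N => m _.
  apply: le_trans (nr_bsum_le (B := B) _ _ _) _; first exact: ltW.
    by move=> w /andP[/Tsub /fB].
  have le1 : 1 <= tot (T n).
    have z2 := sqr_ge0 (T n).2; have wp := weight_ge0 p (T n).1.1 (T n).1.2 (T n).2.
    have wq := weight_ge0 q (T n).1.1 (T n).1.2 (T n).2.
    rewrite /tot; case/orP: zpq => /eqP zE; have := weight_ge1 sn0 (zT n);
      rewrite zE; lra.
  have : 4 * (T n).2 * B <= e.
    move: sn; rewrite -Ts ltr_pdivlMr; last by rewrite ltr_wpDl// mulr_ge0.
    by nra.
  by nra.
(* Regular limit point: [goursat_local] with [e / 8] bounds the sum by [e] times the area. *)
have [l fl] : cderivable f z.
  by move: zpq; rewrite negb_or => /andP[zp zq]; apply: fd => //; apply: (Tsub 0%N).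
have e8 : 0 < e / 8 by rewrite divr_gt0.
have [d d0 dP] := fl _ e8.
have [n sn] : exists n, s / (2 ^ n)%:R < d / 2 by apply: half_pow_lt; rewrite divr_gt0.
have [+ sn0 _] := TP n; apply; exists 0%N => m _.
apply: le_trans (goursat_local (e := e / 8) (l := l) sn0 (zT n) _ (ltW e8) m) _.
  move=> w ws; apply: dP; rewrite (le_lt_trans (square_dist ws (zT n)))//.
  by rewrite Ts; lra.
have wp := weight_ge0 p (T n).1.1 (T n).1.2 (T n).2.
have wq := weight_ge0 q (T n).1.1 (T n).1.2 (T n).2.
by rewrite /tot; nra.
Qed.

End Goursat.

(** * Cauchy estimates in one variable *)

Section Cauchy.
Context {R : realType} {V : normedModType R[i]}.
Implicit Types (f : R[i] -> V) (r e M : R) (z w p : R[i]) (v l : V).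

Lemma cderivable_quotient f p w v : cderivable f p -> p != w ->
  cderivable (fun z => (z - w)^-1 *: (f z - v)) p.
Proof.
move=> [l fl] pw; have pw0 : p - w != 0 by rewrite subr_eq0.
set k := nr (p - w)^-1; have k0 : 0 < k by rewrite nr_gt0 invr_eq0.
(* [A * nr (z - p) ^+ 2] bounds the two second-order terms of the decomposition below, since
   [nr (z - w)^-1 <= 2 * k] near [p]. *)
pose A := 2 * k ^+ 2 * nr l + 2 * k ^+ 3 * nr (f p - v).
have A0 : 0 <= A.
  by rewrite addr_ge0// mulr_ge0 ?nr_ge0// mulr_ge0// exprn_ge0// ltW.
(* The derivative given by the quotient rule. The first-order remainder of [f] costs [e / 2], and
   [d2] leaves [e / 2] for the terms in [A]. *)
exists ((p - w)^-1 *: l - ((p - w)^-1 ^+ 2) *: (f p - v)) => e e0.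
have [d d0 dP] := fl (e / (4 * k)) (divr_gt0 e0 (mulr_gt0 (ltr0n _ 4) k0)).
pose d2 := e / (2 * (A + 1)).
have d20 : 0 < d2 by rewrite divr_gt0// mulr_gt0// ltr_wpDl.
have d30 : 0 < nr (p - w) / 2 by rewrite divr_gt0// nr_gt0.
exists (Num.min d (Num.min d2 (nr (p - w) / 2))); first by rewrite !lt_min d0 d20.
move=> z; rewrite !lt_min => /and3P[/dP {}dP zd2 zd3].
have zw : nr (p - w) / 2 <= nr (z - w).
  by have := nr_dist z p w; rewrite (nr_distC p z); lra.
have zw0 : z - w != 0 by rewrite -nr_gt0; lra.
have kz : nr (z - w)^-1 <= 2 * k.
  rewrite /k !nrV -[X in X * _]invrK -invfM lef_pV2 ?posrE ?nr_gt0//.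
    by rewrite mulrC.
  by rewrite mulr_gt0 ?invr_gt0 ?nr_gt0.
have -> : (z - w)^-1 *: (f z - v) - (p - w)^-1 *: (f p - v) -
   (z - p) *: ((p - w)^-1 *: l - (p - w)^-1 ^+ 2 *: (f p - v)) =
   (z - w)^-1 *: (f z - f p - (z - p) *: l)
   - ((z - p) ^+ 2 * (z - w)^-1 * (p - w)^-1) *: l
   + ((z - p) ^+ 2 * (z - w)^-1 * (p - w)^-1 ^+ 2) *: (f p - v).
  by module_coefs R[i]; field; rewrite ?pw0 ?zw0.
set t := nr (z - p) in zd2 zd3 dP *; have t0 : 0 <= t by exact: nr_ge0.
rewrite (le_trans (nrD _ _))// !nrZ !expr2 !nrM -/t -/k.
apply: (@le_trans _ _ (2 * k * (e / (4 * k) * t)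
   + t * t * (2 * k) * k * nr l + t * t * (2 * k) * (k * k) * nr (f p - v))).
  apply: lerD.
    rewrite (le_trans (nrB _ _))// !nrZ !nrM -/t -/k.
    apply: lerD; first by rewrite ler_pM ?nr_ge0.
    by rewrite ler_wpM2r ?nr_ge0// ler_wpM2r ?(ltW k0)// ler_wpM2l// mulr_ge0.
  rewrite ler_wpM2r ?nr_ge0// ler_wpM2r ?mulr_ge0 ?(ltW k0)//.
  by rewrite ler_wpM2l// mulr_ge0.
have -> : 2 * k * (e / (4 * k) * t) + t * t * (2 * k) * k * nr l +
    t * t * (2 * k) * (k * k) * nr (f p - v) = t * (e / 2 + t * A).
  by rewrite /A; field; rewrite gt_eqF.
rewrite mulrC ler_wpM2r//.
have : t * (2 * (A + 1)) < e by rewrite -ltr_pdivlMr// mulr_gt0// ltr_wpDl.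
by nra.
Qed.

(** Near [w], derivability with tolerance 1 bounds the quotient by [1 + nr l]; at distance at least
    [d], the bound is [(M + M) / d]. At [w] the quotient is 0 because [0^-1 = 0]. *)
Lemma bounded_quotient f w M (S : pred R[i]) :
  (forall z, S z -> nr (f z) <= M) -> S w -> cderivable f w ->
  exists B, forall z, S z -> nr ((z - w)^-1 *: (f z - f w)) <= B.
Proof.
move=> fM Sw [l /(_ 1 ltr01)[d d0 dP]].
have M0 : 0 <= M by rewrite (le_trans (nr_ge0 _) (fM _ Sw)).
exists ((1 + nr l) + (M + M) / d) => z Sz; rewrite nrZ nrV.
have [zd|dz] := ltP (nr (z - w)) d.
  rewrite ler_wpDr ?divr_ge0 ?addr_ge0 ?(ltW d0)//.
  have [->|zw] := eqVneq z w.
    by rewrite subrr nr0 invr0 mul0r addr_ge0// nr_ge0.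
  rewrite mulrC ler_pdivrMr ?nr_gt0 ?subr_eq0//.
  have := nr_dist ((z - w) *: l) (f z - f w) 0.
  by rewrite !subr0 nrZ; have := dP _ zd; lra.
rewrite ler_wpDl ?addr_ge0 ?nr_ge0// mulrC ler_pM ?nr_ge0 ?invr_ge0 ?nr_ge0//.
  by rewrite (le_trans (nrB _ _))// lerD ?fM.
by rewrite lef_pV2 ?posrE// (lt_le_trans d0).
Qed.

Let csquare r := square (- r) (- r) (2 * r).
Let cboundary r := square_boundary (- r) (- r) (2 * r).

Lemma centered_square r z : csquare r z = (`|Re z| <= r) && (`|Im z| <= r).
Proof.
rewrite /csquare /square mulr_natl mulr2n addrA addNr add0r.
by rewrite !ler_norml andbA.
Qed.

Lemma ball_square r z : nr z <= r -> csquare r z.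
Proof.
move=> zr; rewrite centered_square.
by rewrite (le_trans (Re_le_nr _) zr) (le_trans (Im_le_nr _) zr).
Qed.

Lemma boundary_dist r z w : 0 < r -> nr z <= r / 8 -> cboundary r w ->
  7 / 8 * r <= nr (w - z).
Proof.
move=> r0 zr /andP[_]; rewrite mulr_natl mulr2n addrA addNr add0r => rw.
suff : r <= nr w by have := nr_lerB w z; lra.
have ar : `|r| = r by rewrite ger0_norm// ltW.
case/or4P: rw => /eqP wr.
- by apply: le_trans (Re_le_nr w); rewrite wr normrN ar.
- by apply: le_trans (Re_le_nr w); rewrite wr ar.
- by apply: le_trans (Im_le_nr w); rewrite wr normrN ar.
- by apply: le_trans (Im_le_nr w); rewrite wr ar.
Qed.

(** The fraction is the imaginary part of the inverse of [X - 'i * Y]. The ranges are those of the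
    coordinates of [w - z], up to sign and order, for [w] on the boundary of half-side [r] and
    [nr z <= r / 8]. *)
Lemma Im_inv_ge r (X Y : R) : 0 < r -> `|X| <= 9 / 8 * r ->
  7 / 8 * r <= Y <= 9 / 8 * r -> (3 * r)^-1 <= Y / (X ^+ 2 + Y ^+ 2).
Proof.
move=> r0 Xr /andP[rY Yr]; have Y0 : 0 < Y by nra.
rewrite -[leLHS]mul1r ler_pdivrMr ?mulr_gt0// mulrAC ler_pdivlMr; last first.
  by rewrite ltr_wpDl ?sqr_ge0// exprn_gt0.
have : X ^+ 2 <= (9 / 8 * r) ^+ 2.
  by rewrite -[X ^+ 2]real_normK ?num_real// ler_pXn2r// nnegrE//; lra.
by nra.
Qed.

Lemma Im_sum n (F : 'I_n -> R[i]) : Im (\sum_j F j) = \sum_j Im (F j).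
Proof. by elim/big_rec2 : _ => //= j a b _ <-; case: (F j) b => [? ?] []. Qed.

(* The contour integral of [(w - z)^-1] equals [2 * pi * 'i]; a lower bound on
   the modulus of its Riemann sums is enough. *)
Lemma kernel_bsum r z v n : 0 < r -> nr z <= r / 8 ->
  exists2 c, bsum (fun w => (w - z)^-1 *: v) (- r) (- r) (2 * r) n = c *: v
    & 2 <= nr c.
Proof.
case: z => a b r0 zr; rewrite bsumE; set h := 2 * r / _.
set P := fun j : 'I_(2 ^ n) => (- r + j%:R * h)%R.
pose z := a +i* b.
pose F j := ((P j +i* - r) - z)^-1 - ((P j +i* (- r + 2 * r)) - z)^-1 +
  'i * ((((- r + 2 * r) +i* P j) - z)^-1 - ((- r +i* P j) - z)^-1).
exists (h%:C * \sum_j F j).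
  rewrite -scalerA; congr (_ *: _); rewrite scaler_suml; apply: eq_bigr => j _.
  by rewrite /F /P; module_ring R[i].
apply: le_trans (Im_le_nr _); apply: le_trans (ler_norm _).
have -> c : Im (h%:C * c) = h * Im c by case: c => c1 c2 /=; rewrite mul0r addr0.
(* All four sides contribute positive imaginary parts, each at least [(3 * r)^-1]. *)
have FIm j : 4 * (3 * r)^-1 <= Im (F j).
  have Pj : - r <= P j <= r.
    have [+ _ _ _] := square_boundary_grid (- r) (- r) j (mulr_ge0 (ler0n _ 2) (ltW r0)).
    by move=> /andP[/and4P[/= + + _ _] _]; rewrite /P -/h => -> /=; lra.
  have := Re_le_nr (a +i* b); have := Im_le_nr (a +i* b).
  move=> /= /le_trans/(_ zr); rewrite ler_norml => /andP[b1 b2].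
  move=> /le_trans/(_ zr); rewrite ler_norml => /andP[a1 a2].
  have I1 : (3 * r)^-1 <= (r + b) / ((P j - a) ^+ 2 + (r + b) ^+ 2).
    by apply: Im_inv_ge => //; rewrite ?ler_norml; apply/andP; split; lra.
  have I2 : (3 * r)^-1 <= (r - b) / ((P j - a) ^+ 2 + (r - b) ^+ 2).
    by apply: Im_inv_ge => //; rewrite ?ler_norml; apply/andP; split; lra.
  have I3 : (3 * r)^-1 <= (r - a) / ((P j - b) ^+ 2 + (r - a) ^+ 2).
    by apply: Im_inv_ge => //; rewrite ?ler_norml; apply/andP; split; lra.
  have I4 : (3 * r)^-1 <= (r + a) / ((P j - b) ^+ 2 + (r + a) ^+ 2).
    by apply: Im_inv_ge => //; rewrite ?ler_norml; apply/andP; split; lra.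
  have FE : Im (F j) = (r + b) / ((P j - a) ^+ 2 + (r + b) ^+ 2) +
     (r - b) / ((P j - a) ^+ 2 + (r - b) ^+ 2) +
     (r - a) / ((P j - b) ^+ 2 + (r - a) ^+ 2) +
     (r + a) / ((P j - b) ^+ 2 + (r + a) ^+ 2).
    have e1 : (- r - b) ^+ 2 = (r + b) ^+ 2 by ring.
    have e2 : (- r + 2 * r - b) = r - b by ring.
    have e3 : (- r - a) ^+ 2 = (r + a) ^+ 2 by ring.
    have e4 : (- r + 2 * r - a) = r - a by ring.
    rewrite /F /= e1 e2 e3 e4 [(r - a) ^+ 2 + _]addrC [(r + a) ^+ 2 + _]addrC.
    by ring.
  by rewrite [leRHS]FE; lra.
(* The lower bound adds up to [2 * r * 4 / (3 * r) = 8 / 3], at every level [n]. *)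
rewrite Im_sum; apply: (@le_trans _ _ (h * \sum_(j < 2 ^ n) (4 * (3 * r)^-1))).
  rewrite sumr_const card_ord -[X in h * X]mulr_natr /h.
  suff -> : 2 * r / (2 ^ n)%:R * (4 / (3 * r) * (2 ^ n)%:R) = 8 / 3 by lra.
  by field; rewrite natr2X_neq0 gt_eqF.
rewrite ler_wpM2l//; last exact: ler_sum.
by rewrite divr_ge0// mulr_ge0// ltW.
Qed.

(* Cauchy's formula on a square, for the difference of the values at [z] and
   [z']; an exceptional point [p] is allowed so that the estimate applies to
   difference quotients as well. *)
Lemma cauchy_lipschitz f r M p z z' : 0 < r ->
  (forall w, csquare r w -> nr (f w) <= M) ->
  (forall w, csquare r w -> w != p -> cderivable f w) ->
  nr z <= r / 8 -> nr z' <= r / 8 -> z != p -> z' != p ->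
  nr (f z - f z') <= 12 * M / r * nr (z - z').
Proof.
move=> r0 fM fd zr z'r zp z'p.
have s0 : 0 < 2 * r by rewrite mulr_gt0.
have csq w : nr w <= r / 8 -> csquare r w by move=> wr; apply: ball_square; lra.
have M0 : 0 <= M by rewrite (le_trans (nr_ge0 _) (fM _ (csq _ zr))).
(* Goursat's lemma for the difference quotient at [w], with exceptional points [p] and [w]. *)
have small w e : nr w <= r / 8 -> w != p -> 0 < e -> exists N, forall n,
    (N <= n)%N ->
    nr (bsum (fun u => (u - w)^-1 *: (f u - f w)) (- r) (- r) (2 * r) n) <= e.
  move=> wr wp e0.
  have [B HB] := bounded_quotient fM (csq _ wr) (fd _ (csq _ wr) wp).
  apply: (goursat (p := p) (q := w) s0 HB _ e0) => u us up uw.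
  by apply: cderivable_quotient => //; apply: fd.
apply/ler_addgt0Pr => e e0.
have [N HN] := small z e zr zp e0; have [N' HN'] := small z' e z'r z'p e0.
have {HN}H1 := HN (maxn N N') (leq_maxl _ _).
have {HN'}H2 := HN' (maxn N N') (leq_maxr _ _).
set n := maxn N N' in H1 H2.
have [c cE c2] := kernel_bsum (f z' - f z) n r0 zr.
(* [E] is the difference of the two quotients, up to a multiple of the kernel whose sum is
   [c *: (f z' - f z)]. The quotients have small sums, so a bound on [E] bounds [f z' - f z]. *)
pose E w := ((w - z)^-1 - (w - z')^-1) *: (f w - f z').
have EE : bsum E (- r) (- r) (2 * r) n =
    bsum (fun u => (u - z)^-1 *: (f u - f z)) (- r) (- r) (2 * r) n
    - bsum (fun u => (u - z')^-1 *: (f u - f z')) (- r) (- r) (2 * r) n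
    - c *: (f z' - f z).
  rewrite -cE -!bsumB; apply: eq_bsum => [|w _]; first exact: ltW.
  by rewrite /E; module_ring R[i].
(* On the contour, of length [8 * r], both distances are at least [7 / 8 * r] and [f w - f z'] is at
   most [2 * M]; then [2 * (8 / 7) ^+ 2 = 128 / 49 <= 3]. *)
have Ele : nr (bsum E (- r) (- r) (2 * r) n) <= 24 * M / r * nr (z - z').
  have -> : 24 * M / r * nr (z - z') =
      4 * (2 * r) * (3 * M / r ^+ 2 * nr (z - z')).
    by field; rewrite gt_eqF.
  apply: nr_bsum_le => [|w bw]; first exact: ltW.
  have wz := boundary_dist r0 zr bw; have wz' := boundary_dist r0 z'r bw.
  have wz0 : 0 < nr (w - z) by nra.
  have wz'0 : 0 < nr (w - z') by nra.
  have -> : E w = ((z - z') * (w - z)^-1 * (w - z')^-1) *: (f w - f z').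
    rewrite /E; congr (_ *: _); field.
    by rewrite -!nr_gt0 wz0 wz'0.
  rewrite nrZ !nrM !nrV.
  have fw : nr (f w - f z') <= 2 * M.
    rewrite (le_trans (nrB _ _))// mulr_natl mulr2n lerD// fM//.
      by case/andP: bw.
    exact: csq.
  apply: (@le_trans _ _ (nr (z - z') * (7 / 8 * r)^-1 * (7 / 8 * r)^-1 * (2 * M))).
    have r7 : 0 < 7 / 8 * r by lra.
    rewrite ler_pM ?nr_ge0// ?mulr_ge0 ?invr_ge0 ?nr_ge0//.
    rewrite ler_pM ?mulr_ge0 ?invr_ge0 ?nr_ge0//.
      by rewrite ler_wpM2l ?nr_ge0// lef_pV2// posrE.
    by rewrite lef_pV2// posrE.
  have -> : nr (z - z') * (7 / 8 * r)^-1 * (7 / 8 * r)^-1 * (2 * M) =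
      128 / 49 * (M / r ^+ 2 * nr (z - z')) by field; rewrite gt_eqF.
  have : 0 <= M / r ^+ 2 * nr (z - z').
    by rewrite mulr_ge0 ?nr_ge0// divr_ge0// exprn_ge0// ltW.
  have -> : 3 * M / r ^+ 2 * nr (z - z') = 3 * (M / r ^+ 2 * nr (z - z')).
    by rewrite !mulrA.
  by lra.
have : nr (c *: (f z' - f z)) <= 24 * M / r * nr (z - z') + e + e.
  set b1 := bsum _ _ _ _ _ in H1; set b2 := bsum _ _ _ _ _ in H2.
  rewrite -/b1 -/b2 in EE.
  have -> : c *: (f z' - f z) = b1 - b2 - bsum E (- r) (- r) (2 * r) n.
    by rewrite EE; module_ring R[i].
  by have := nrB (b1 - b2) (bsum E (- r) (- r) (2 * r) n); have := nrB b1 b2; lra.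
(* Since [nr c >= 2], the constant 24 is halved and the error [e + e] becomes [e]. *)
rewrite nrZ nr_distC.
have := nr_ge0 (f z - f z').
have -> : 24 * M / r * nr (z - z') = 2 * (12 * M / r * nr (z - z')).
  by rewrite !mulrA; congr (_ / _ * _); rewrite -natrM.
nra.
Qed.

(** [cauchy_lipschitz] applies to the difference quotient [D] at 0, with exceptional point 0.
    Comparing [D z] with [D t] for small [t], where [D t] is close to [l], gives the constant
    [12 * 16 = 192]. *)
Lemma cauchy_taylor f r M l z : 0 < r ->
  (forall w, csquare r w -> nr (f w) <= M) ->
  (forall w, csquare r w -> cderivable f w) ->
  is_cderive f 0 l -> nr z <= r / 8 ->
  nr (f z - f 0 - z *: l) <= 192 * M / r ^+ 2 * nr z ^+ 2.
Proof.
move=> r0 fM fd fl zr.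
have c0 : csquare r 0 by apply: ball_square; rewrite nr0 ltW.
have M0 : 0 <= M by rewrite (le_trans (nr_ge0 _) (fM _ c0)).
have r8 : 0 <= r / 8 by lra.
have lip u (v : R[i]) : nr u <= r / 8 -> nr v <= r / 8 ->
    nr (f u - f v) <= 12 * M / r * nr (u - v).
  (* A dummy exceptional point, outside of the square. *)
  move=> ur vr; apply: (@cauchy_lipschitz _ _ _ (2 * r)%:C) => //.
  - by move=> w wr _; apply: fd.
  - by apply/eqP => E; move: ur; rewrite E nr_real ger0_norm; lra.
  - by apply/eqP => E; move: vr; rewrite E nr_real ger0_norm; lra.
pose D w := (w - 0)^-1 *: (f w - f 0).
(* Within [r / 8] the Lipschitz bound gives [12 * M / r]; beyond, [2 * M] divided by [r / 8] gives
   [16 * M / r]. *)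
have DM w : csquare r w -> nr (D w) <= 16 * M / r.
  move=> wr; rewrite /D nrZ nrV subr0.
  have [->|w0] := eqVneq w 0.
    by rewrite nr0 invr0 mul0r divr_ge0 ?mulr_ge0// ltW.
  rewrite mulrC ler_pdivrMr ?nr_gt0//.
  have [wle|/ltW wge] := leP (nr w) (r / 8).
    have := lip w 0 wle; rewrite nr0 subr0 => /(_ r8)/le_trans; apply.
    by rewrite ler_wpM2r ?nr_ge0// ler_wpM2r ?invr_ge0 ?(ltW r0)//; lra.
  have := nrB (f w) (f 0); have := fM _ wr; have := fM _ c0 => f0 fw ?.
  apply: (@le_trans _ _ (2 * M)); first by lra.
  apply: (@le_trans _ _ (16 * M / r * (r / 8))).
    suff -> : 16 * M / r * (r / 8) = 2 * M by [].
    by field; rewrite gt_eqF.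
  by rewrite ler_wpM2l// divr_ge0 ?mulr_ge0// ltW.
have Dd w : csquare r w -> w != 0 -> cderivable D w.
  by move=> wr w0; apply: cderivable_quotient => //; apply: fd.
have [->|z0] := eqVneq z 0; first by rewrite scale0r subrr subr0 !nr0 expr0n/= mulr0.
have nz : 0 < nr z by rewrite nr_gt0.
have -> : f z - f 0 - z *: l = z *: (D z - l).
  by rewrite /D subr0; module_coefs R[i]; field.
rewrite nrZ expr2 mulrA mulrC ler_wpM2r ?nr_ge0//.
apply/ler_addgt0Pr => e e0.
have [d d0 dP] := fl (e / 2) (divr_gt0 e0 (ltr0n _ 2)).
pose K := 192 * M / r ^+ 2.
have K0 : 0 <= K by rewrite divr_ge0 ?sqr_ge0// mulr_ge0.
(* [t] stays in the disc of the Lipschitz estimate, makes [D t] within [e / 2] of [l], and satisfies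
   [K * t <= e / 2]. *)
pose t := Num.min (r / 8) (Num.min (d / 2) (e / (2 * (K + 1)))).
have t0 : 0 < t by rewrite !lt_min !divr_gt0// mulr_gt0// ltr_wpDl.
have [tr td te] : [/\ t <= r / 8, t < d & t * (2 * (K + 1)) <= e].
  split; first by rewrite ge_min lexx.
    by rewrite !gt_min; apply/orP; right; apply/orP; left; lra.
  rewrite -ler_pdivlMr; last by rewrite mulr_gt0// ltr_wpDl.
  by rewrite !ge_min lexx !orbT.
have nt : nr (t%:C : R[i]) = t by rewrite nr_real gtr0_norm.
have tC0 : (t%:C : R[i]) != 0 by rewrite -nr_gt0 nt.
have : nr (D t%:C - l) <= e / 2.
  have -> : D t%:C - l = t%:C^-1 *: (f t%:C - f 0 - (t%:C - 0) *: l).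
    by rewrite /D subr0; module_coefs R[i]; field.
  rewrite nrZ nrV mulrC ler_pdivrMr ?nt// -{2}nt.
  by have := dP t%:C; rewrite !subr0 nt; apply.
have : nr (D z - D t%:C) <= K * (nr z + t).
  apply: (@le_trans _ _ (12 * (16 * M / r) / r * nr (z - t%:C))).
    by apply: (cauchy_lipschitz r0 DM Dd); rewrite ?nt.
  have -> : 12 * (16 * M / r) / r = K by rewrite /K; field; rewrite gt_eqF.
  by rewrite ler_wpM2l// -{2}nt nrB.
have := nr_dist (D t%:C) (D z) l; rewrite -/K; nra.
Qed.

End Cauchy.

(** * Estimates in several variables, by restriction to complex lines *)

Section Frechet.
Context {R : realType} {W V : normedModType R[i]}.
Implicit Types (f : W -> V) (a h : W) (r e M : R).

(** Trades radii in [R[i]] for real ones: a positive element of [R[i]] is real. *)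
Lemma nbhs_nrP (U : normedModType R[i]) (a : U) (P : set U) :
  nbhs a P <-> exists2 d : R, 0 < d & forall b, nr (b - a) < d -> P b.
Proof.
split=> [/nbhs_normP[d /= d0 dP]|[d d0 dP]]; last first.
  apply/nbhs_normP; exists d%:C => /=; first by rewrite ltcR.
  by move=> b /=; rewrite nrE ltcR nr_distC; exact: dP.
have dE : d = (Re d)%:C by rewrite RRe_real// ger0_real// ltW.
exists (Re d) => [|b bd]; first by rewrite -ltcR -dE.
by apply: dP; rewrite /= nrE dE ltcR nr_distC.
Qed.

Lemma littleo_nr (f : W -> V) (U : normedModType R[i]) (k : W -> U) a :
  (forall e : R[i], 0 < e -> \forall b \near a, `|f b| <= e * `|k b|) <->
  forall e, 0 < e ->
    exists2 d : R, 0 < d & forall b, nr (b - a) < d -> nr (f b) <= e * nr (k b).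
Proof.
split=> [fk e e0|fk e e0].
  have [|d d0 dP] := (nbhs_nrP _ _).1 (fk e%:C _); first by rewrite ltcR.
  by exists d => // b /dP; rewrite !nrE -rmorphM/= lecR.
have eE : e = (Re e)%:C by rewrite RRe_real// ger0_real// ltW.
have [|d d0 dP] := fk (Re e); first by rewrite -ltcR -eE.
apply/nbhs_nrP; exists d => // b /dP; rewrite eE !nrE -rmorphM/= lecR//.
Qed.

Lemma diff_nr f a : differentiable f a -> forall e, 0 < e ->
  exists2 d : R, 0 < d &
    forall h, nr h < d -> nr (f (h + a) - f a - 'd f a h) <= e * nr h.
Proof.
move=> /diff_locallyP[_ /eqaddoP fo] e e0.
have [d d0 dP] := (littleo_nr _ _ _).1 fo _ e0.
exists d => // h hd; have := dP h; rewrite subr0 => /(_ hd).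
by rewrite -[f (h + a) - _ - _]addrA -opprD.
Qed.

Lemma differentiable_nr f a (L : {linear W -> V}) : continuous L ->
  (forall e, 0 < e -> exists2 d : R, 0 < d &
    forall h, nr h < d -> nr (f (h + a) - f a - L h) <= e * nr h) ->
  differentiable f a.
Proof.
move=> cL fL.
have fo : f \o shift a = cst (f a) + L +o_ 0 id.
  apply/eqaddoP/littleo_nr => e /fL[d d0 dP]; exists d => // h.
  by rewrite subr0 => /dP; rewrite -[f (h + a) - _ - _]addrA -opprD.
have dL := diff_unique cL fo.
by apply/diff_locallyP; rewrite dL.
Qed.

Lemma diff_line f a h (z : R[i]) : differentiable f (a + z *: h) ->
  is_cderive (fun w => f (a + w *: h)) z ('d f (a + z *: h) h).
Proof.
move=> fd e e0.
have h1 : 0 < nr h + 1 by rewrite ltr_wpDl// nr_ge0.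
have [d d0 dP] := diff_nr fd (divr_gt0 e0 h1).
exists (d / (nr h + 1)) => [|w wz]; first by rewrite divr_gt0.
have /dP : nr ((w - z) *: h) < d.
  move: wz; rewrite nrZ ltr_pdivlMr//; apply: le_lt_trans.
  by rewrite ler_wpM2l ?nr_ge0// lerDl.
have -> : (w - z) *: h + (a + z *: h) = a + w *: h by module_ring R[i].
rewrite linearZ/= => /le_trans; apply; rewrite nrZ mulrCA -[leRHS]mulrC.
rewrite ler_wpM2l ?nr_ge0// -mulrA ler_piMr ?(ltW e0)//.
by rewrite mulrC ler_pdivrMr// mul1r lerDl.
Qed.

Definition bounded_holomorphic_on_ball f a (r M : R) : Prop :=
  forall b, nr (b - a) <= r -> differentiable f b /\ nr (f b) <= M.

Lemma unit_direction h : h != 0 ->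
  exists2 h1, nr h1 = 1 & h = (nr h)%:C *: h1.
Proof.
move=> h0; have nh : (nr h)%:C != 0 :> R[i].
  by rewrite -nr_gt0 nr_real normr_gt0 nr_eq0.
exists ((nr h)%:C^-1 *: h); last by rewrite scalerA divff// scale1r.
by rewrite nrZ nrV nr_real ger0_norm ?nr_ge0// mulVf// nr_eq0.
Qed.

(** The half-side is [r / 2] because [nr w] is bounded by the sum of the two coordinates. *)
Lemma line_in_ball f a r M h1 : bounded_holomorphic_on_ball f a r M ->
  nr h1 = 1 -> forall w, square (- (r / 2)) (- (r / 2)) (2 * (r / 2)) w ->
  nr (f (a + w *: h1)) <= M /\ differentiable f (a + w *: h1).
Proof.
move=> fb h1E w; rewrite centered_square => /andP[w1 w2].
have /fb[] : nr (a + w *: h1 - a) <= r; last by [].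
rewrite addrC addKr nrZ h1E mulr1 (le_trans (nr_le_ReIm _))//.
by rewrite [leRHS]splitr lerD.
Qed.

(** The one-variable estimate along the direction of [h], at half-side [r / 2]: hence
    [r / 16 = r / 2 / 8] and [24 = 2 * 12]. *)
Lemma holomorphic_lipschitz f a r M h : 0 < r ->
  bounded_holomorphic_on_ball f a r M -> nr h <= r / 16 ->
  nr (f (a + h) - f a) <= 24 * M / r * nr h.
Proof.
move=> r0 fb hr; have [->|h0] := eqVneq h 0.
  by rewrite addr0 subrr !nr0 mulr0.
have [h1 h1E hE] := unit_direction h0.
have r2 : 0 < r / 2 by rewrite divr_gt0.
have fl := line_in_ball fb h1E.
have hN : nr (nr h)%:C = nr h by rewrite nr_real ger0_norm ?nr_ge0.
(* The exceptional point [r] lies outside of the square of half-side [r / 2]. *)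
have := @cauchy_lipschitz _ _ (fun w => f (a + w *: h1)) (r / 2) M r%:C
  (nr h)%:C 0 r2 _ _ _ _ _ _.
rewrite -hE scale0r addr0 subr0 hN nr0.
have -> : 12 * M / (r / 2) * nr h = 24 * M / r * nr h by field; rewrite gt_eqF.
apply.
- by move=> w /fl[].
- by move=> w /fl[_ fd] _; exists ('d f (a + w *: h1) h1); exact: diff_line.
- by rewrite (le_trans hr)//; lra.
- by lra.
- by apply/eqP => /(congr1 (@complex.Re R)) /= hrE; lra.
- by apply/eqP => /(congr1 (@complex.Re R)) /= rE; lra.
Qed.

Lemma holomorphic_taylor f a r M h : 0 < r ->
  bounded_holomorphic_on_ball f a r M -> nr h <= r / 16 ->
  nr (f (a + h) - f a - 'd f a h) <= 768 * M / r ^+ 2 * nr h ^+ 2.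
Proof.
move=> r0 fb hr; have [->|h0] := eqVneq h 0.
  by rewrite addr0 subrr linear0 subr0 !nr0 expr0n mulr0.
have [h1 h1E hE] := unit_direction h0.
have r2 : 0 < r / 2 by rewrite divr_gt0.
have fl := line_in_ball fb h1E.
have hN : nr (nr h)%:C = nr h by rewrite nr_real ger0_norm ?nr_ge0.
have := @cauchy_taylor _ _ (fun w => f (a + w *: h1)) (r / 2) M ('d f a h1)
  (nr h)%:C r2 _ _ _ _.
rewrite -linearZ/= -hE scale0r addr0 hN.
have -> : 192 * M / (r / 2) ^+ 2 * nr h ^+ 2 = 768 * M / r ^+ 2 * nr h ^+ 2.
  by field; rewrite gt_eqF.
apply.
- by move=> w /fl[].
- by move=> w /fl[_ fd]; exists ('d f (a + w *: h1) h1); exact: diff_line.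
- have := @diff_line f a h1 0; rewrite scale0r addr0; apply.
  by have /fb[] : nr (a - a) <= r by rewrite subrr nr0 ltW.
- by rewrite (le_trans hr)//; lra.
Qed.

End Frechet.

(** * Unitary operators *)

Section Hilbert.
Context {R : realType} {H : hilbertType R[i]}.
Implicit Types (x y z w : H) (a b c : R[i]).

Local Notation "''[' x , y ]" := (hdot x y) : ring_scope.

Lemma hdotDl x y z : '[x + y, z] = '[x, z] + '[y, z].
Proof. exact: linearDl. Qed.
Lemma hdotDr x y z : '[x, y + z] = '[x, y] + '[x, z].
Proof. exact: linearDr. Qed.
Lemma hdotNl x y : '[- x, y] = - '[x, y].
Proof. exact: linearNl. Qed.
Lemma hdotNr x y : '[x, - y] = - '[x, y].
Proof. exact: linearNr. Qed.
Lemma hdotZl a x y : '[a *: x, y] = a * '[x, y].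
Proof. exact: linearZl_LR. Qed.
Lemma hdotZr a x y : '[x, a *: y] = Num.conj a * '[x, y].
Proof. exact: linearZr_LR. Qed.
Lemma hdot0l x : '[0, x] = 0.
Proof. exact: linear0l. Qed.
Lemma hdot0r x : '[x, 0] = 0.
Proof. exact: linear0r. Qed.
Lemma hdotC x y : '[x, y] = Num.conj '[y, x].
Proof. by rewrite (hermC hdot) expr0 mul1r. Qed.
Lemma hdot_suml n (F : 'I_n -> H) y : '[\sum_j F j, y] = \sum_j '[F j, y].
Proof.
by elim/big_rec2 : _ => [|j u v _ <-]; rewrite ?hdot0l// hdotDl.
Qed.
Lemma hdot_eq0 x : '[x, x] = 0 -> x = 0.
Proof. by move=> /eqP; rewrite -hdot_norm sqrf_eq0 normr_eq0 => /eqP. Qed.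

Lemma unitary_nr (U : {linear H -> H}) x : unitary U -> nr (U x) = nr x.
Proof.
move=> [_ iU]; have : `|U x| ^+ 2 = `|x| ^+ 2 by rewrite !hdot_norm; exact: iU.
by move=> /eqP; rewrite eqrXn2 ?normr_ge0// => /eqP E; rewrite /nr E.
Qed.

Lemma unitary_id : unitary (idfun : {linear H -> H}).
Proof. by split; [exists idfun|]. Qed.

Lemma unitary_comp (U W : {linear H -> H}) :
  unitary U -> unitary W -> unitary (U \o W : {linear H -> H}).
Proof.
move=> [bU iU] [bW iW]; split; first exact: bij_comp.
by move=> x y; rewrite /= iU iW.
Qed.

(** A complex reflection: sending [x] to [y] when ['[x, y]] is not real takes a non-real [c]. *)
Definition householder c w x : H := x - (c * '[x, w]) *: w.

Lemma householder_is_linear c w : linear (householder c w).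
Proof.
move=> a x y; rewrite /householder hdotDl hdotZl; module_ring R[i].
Qed.

HB.instance Definition _ c w :=
  GRing.isLinear.Build _ _ _ _ (householder c w) (householder_is_linear c w).

Lemma householderK c w : c + Num.conj c = c * Num.conj c * '[w, w] ->
  cancel (householder c w) (householder (Num.conj c) w).
Proof.
move=> cw x; rewrite /householder hdotDl hdotNl hdotZl.
set d := '[x, w]; have -> : Num.conj c * (d - c * d * '[w, w]) = - c * d.
  by rewrite mulrBr; ring: (esym cw).
by module_ring R[i].
Qed.

(** The operator fixes the orthogonal complement of [w] and multiplies [w] by [1 - c * '[w, w]]; for
    nonzero [w] the condition says that this factor has modulus 1. *)
Lemma householder_unitary c w : c + Num.conj c = c * Num.conj c * '[w, w] ->
  unitary (householder c w : {linear H -> H}).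
Proof.
move=> cw; split.
  exists (householder (Num.conj c) w); first exact: householderK.
  rewrite -{2}(conjCK c); apply: householderK; rewrite conjCK.
  by rewrite addrC cw; ring.
move=> x y; rewrite /= /householder !(hdotDl, hdotDr, hdotNl, hdotNr, hdotZl, hdotZr).
rewrite (hdotC w y) rmorphM; set d := '[x, w]; set f := Num.conj _.
rewrite -/f; ring: (esym cw).
Qed.

(** With [w = x - y] and [c = '[x, w]^-1], the reflection sends [x] to [x - w = y]. Equality of the
    norms gives ['[x, w] + '[w, x] = '[w, w]], which is the unitarity condition and makes ['[x, w]]
    nonzero. *)
Lemma unitary_transport x y : '[x, x] = '[y, y] ->
  exists U : {linear H -> H}, [/\ unitary U, U x = y &
    forall z, '[z, x] = 0 -> '[z, y] = 0 -> U z = z].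
Proof.
move=> xy; pose w := x - y; have [w0|w0] := eqVneq w 0.
  exists idfun; split=> [||//]; first exact: unitary_id.
  by apply/eqP; rewrite -subr_eq0; apply/eqP.
have ww : '[x, w] + '[w, x] = '[w, w].
  by rewrite /w !(hdotDl, hdotDr, hdotNl, hdotNr) xy; ring.
have xw0 : '[x, w] != 0.
  apply: contra_neq w0 => xw; apply: hdot_eq0.
  by rewrite -ww (hdotC w) xw rmorph0 addr0.
exists (householder '[x, w]^-1 w); split.
- have cj : Num.conj '[x, w]^-1 = '[w, x]^-1 by rewrite fmorphV [RHS]/= (hdotC w).
  apply: householder_unitary; rewrite cj -ww.
  have wx0 : '[w, x] != 0 by rewrite hdotC fmorph_eq0.
  by field; rewrite xw0 wx0.
- by rewrite /= /householder mulVf// scale1r /w opprB addrC subrK.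
- move=> z zx zy; have zw : '[z, w] = 0 by rewrite hdotDr hdotNr zx zy subr0.
  by rewrite /= /householder zw mulr0 scale0r subr0.
Qed.

(* [e] is an orthonormal sequence, padded with zeros when [H] has finite
   dimension. *)
Definition orthonormal_seq (e : nat -> H) : Prop :=
  [/\ forall i j, (i < j)%N -> '[e j, e i] = 0,
      forall i, e i = 0 \/ '[e i, e i] = 1 &
      forall i, e i = 0 -> forall x, (forall j, (j < i)%N -> '[x, e j] = 0) -> x = 0].

(** Recursive choice of a unit vector orthogonal to the previous ones, or of 0 if there is none. *)
Lemma orthonormal_seq_ex : exists e, orthonormal_seq e.
Proof.
have /choice[pick pickP] : forall s : seq H, exists x : H,
    (forall y, y \in s -> '[x, y] = 0) /\
    ('[x, x] = 1 \/ x = 0 /\ forall z, (forall y, y \in s -> '[z, y] = 0) -> z = 0).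
  move=> s; have [[z [zs z0]]|nz] :=
    pselect (exists z, (forall y, y \in s -> '[z, y] = 0) /\ z != 0).
    exists (`|z|^-1 *: z); split=> [y /zs zy|]; first by rewrite hdotZl zy mulr0.
    left; rewrite hdotZl hdotZr -hdot_norm conj_Creal ?rpredV ?normr_real//.
    by field; rewrite normr_eq0.
  exists 0; split=> [y _|]; first exact: hdot0l.
  right; split=> // z zs; apply/eqP; apply: contrapT => z0; apply: nz.
  by exists z; split=> //; apply/negP.
pose s n := iter n (fun t => rcons t (pick t)) [::].
pose e n := pick (s n).
have sE n x : x \in s n <-> exists2 i, (i < n)%N & x = e i.
  elim: n => [|n IHn]; first by split=> // -[].
  rewrite /= mem_rcons inE; split=> [|[j]].
    by case/predU1P=> [->|/IHn[i ilt ->]]; [exists n|exists i => //; exact: ltnW].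
  rewrite ltnS leq_eqVlt => /predU1P[-> ->|jn xe]; first by rewrite eqxx.
  by apply/orP; right; apply/IHn; exists j.
exists e; split=> [i j ij|i|i ei x xP].
- by have [+ _] := pickP (s j); apply; apply/sE; exists i.
- by have [_ [|[]]] := pickP (s i); [right|left].
- have [_ [E|[_]]] := pickP (s i).
    by move: (oner_neq0 R[i]); rewrite -E -/(e i) ei hdot0l eqxx.
  by apply=> y /sE[j ji ->]; exact: xP.
Qed.

(** * Triangularization with respect to an orthonormal sequence *)

Section Span.
Context (e : nat -> H) (oe : orthonormal_seq e).

Lemma hdot_orth i j : i != j -> '[e i, e j] = 0.
Proof.
have [eo _ _] := oe; rewrite neq_ltn => /orP[/eo E|/eo//].
by rewrite hdotC E rmorph0.
Qed.

Lemma hdot_unit i c : (c * '[e i, e i]) *: e i = c *: e i.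
Proof. by have [_ /(_ i)[->|->] _] := oe; rewrite ?scaler0 ?mulr1. Qed.

Lemma hdot_comb m (c : nat -> R[i]) i : (i < m)%N ->
  '[\sum_(j < m) c j *: e j, e i] = c i * '[e i, e i].
Proof.
move=> im; rewrite hdot_suml (bigD1 (Ordinal im))//= hdotZl big1 ?addr0// => j.
by rewrite -(inj_eq val_inj)/= hdotZl => /hdot_orth->; rewrite mulr0.
Qed.

(** Membership in the span is stated through the Fourier expansion, which provides bounded
    coefficients. *)
Definition in_span m x := x = \sum_(j < m) '[x, e j] *: e j.

Lemma in_span_comb m (c : nat -> R[i]) : in_span m (\sum_(j < m) c j *: e j).
Proof.
by apply: eq_bigr => j _; rewrite hdot_comb// hdot_unit.
Qed.

(* Gram-Schmidt orthonormalization, performed by rotating the vectors rather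
   than by choosing a new orthonormal system. *)
Lemma unitary_triangularization (v : nat -> H) k :
  exists U : {linear H -> H}, unitary U /\
    forall i, (i < k)%N -> in_span i.+1 (U (v i)).
Proof.
elim: k => [|k [U [uU Uv]]]; first by exists idfun; split=> //; exact: unitary_id.
pose p := \sum_(j < k) '[U (v k), e j] *: e j; pose q := U (v k) - p.
have qe i : (i < k)%N -> '[q, e i] = 0.
  move=> ik; rewrite hdotDl hdotNl (hdot_comb (fun j => '[U (v k), e j]))//.
  by have [_ /(_ i)[->|->] _] := oe; rewrite ?hdot0r ?mulr1 ?mulr0 subrr.
have ek : e k = 0 -> q = 0.
  by have [_ _ +] := oe => /[apply]; apply => j; exact: qe.
(* Rotates the residue [q] of the projection onto the axis of [e k]; if [e k] is 0 then so is [q],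
   and the norms still agree. *)
have [W [uW Wq We]] : exists W : {linear H -> H}, [/\ unitary W,
    W q = `|q| *: e k & forall z, '[z, q] = 0 -> '[z, `|q| *: e k] = 0 -> W z = z].
  apply: unitary_transport; rewrite hdotZl hdotZr -hdot_norm.
  rewrite conj_Creal ?normr_real//.
  have [_ /(_ k)[ek0|->] _] := oe; last by rewrite mulr1.
  by rewrite ek0 (ek ek0) normr0 !mul0r expr0n.
(* The [e j] with [j < k] are orthogonal to both [q] and [e k], so [W] leaves the vectors already
   treated in place. *)
have Wfix m x : (m <= k)%N -> in_span m x -> W x = x.
  move=> mk xm; apply: We.
    rewrite xm hdot_suml big1// => j _; rewrite hdotZl (hdotC _ q) qe ?rmorph0 ?mulr0//.
    exact: leq_trans mk.
  rewrite xm hdot_suml big1// => j _; rewrite hdotZl hdotZr hdot_orth ?mulr0//.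
  by rewrite neq_ltn (leq_trans _ mk).
exists (W \o U); split; first exact: unitary_comp.
move=> i; rewrite ltnS leq_eqVlt => /predU1P[->|ik] /=; last first.
  by rewrite (Wfix i.+1)//; exact: Uv.
have -> : U (v k) = p + q by rewrite /q addrC subrK.
rewrite linearD/= Wq (Wfix k p)//; last exact: (in_span_comb k (fun j => '[U (v k), e j])).
pose c j := if j == k then `|q| else '[U (v k), e j].
suff -> : p + `|q| *: e k = \sum_(j < k.+1) c j *: e j by exact: in_span_comb.
rewrite big_ord_recr/= {2}/c eqxx; congr (_ + _); apply: eq_bigr => j _.
by rewrite /c ltn_eqF.
Qed.

Lemma nr_hdot_le x i : nr '[x, e i] <= nr x.
Proof.
have [_ /(_ i)[->|ei] _] := oe; first by rewrite hdot0r nr0 nr_ge0.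
rewrite -lecR -!nrE -(@ler_pXn2r _ 2) ?nnegrE// hdot_norm normCK.
rewrite -subr_ge0; set c := '[x, e i].
have -> : '[x, x] - c * Num.conj c = '[x - c *: e i, x - c *: e i].
  rewrite !(hdotDl, hdotDr, hdotNl, hdotNr, hdotZl, hdotZr) ei.
  by rewrite (hdotC (e i) x) -/c; ring.
by rewrite -hdot_norm exprn_ge0.
Qed.

End Span.
End Hilbert.

(** * Subsequences *)

Section UltraLimits.
Context {R : realType} (F : set_system nat) {FU : UltraFilter F}.

(** The limit is the supremum of the [t] that are below [a k] for [F]-almost all [k]. As [F] is
    ultra, not being almost always above [sup S + e / 2] means being almost always below it. *)
Lemma ultra_real (a : nat -> R) (M : R) : (forall k, `|a k| <= M) ->
  exists l : R, forall e : R, 0 < e -> \forall k \near F, `|a k - l| < e.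
Proof.
move=> aM; pose S := [set t | \forall k \near F, t <= a k].
have SM : has_sup S.
  split; first by exists (- M); apply: filterE => k; have := aM k; rewrite ler_norml => /andP[].
  exists M => t St; have [k tk] := filter_ex St.
  by rewrite (le_trans tk)// (le_trans (ler_norm _)).
exists (sup S) => e e0.
have [t St tl] : exists2 t, S t & sup S - e < t by apply: sup_adherent.
have nS : ~ S (sup S + e / 2).
  move=> /(ub_le_sup (proj2 SM)); lra.
have [//|Sc] := in_ultra_setVsetC [set k | sup S + e / 2 <= a k] FU.
near=> k; have tk : t <= a k by near: k.
have : ~ (sup S + e / 2 <= a k) by near: k.
by move=> /negP; rewrite -ltNge => ?; rewrite ltr_norml; apply/andP; split; lra.
Unshelve. all: by end_near. Qed.

Lemma ultra_complex (c : nat -> R[i]) (M : R) : (forall k, nr (c k) <= M) ->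
  exists l : R[i], forall e : R, 0 < e -> \forall k \near F, nr (c k - l) < e.
Proof.
move=> cM.
have [a aP] := @ultra_real (fun k => Re (c k)) M
  (fun k => le_trans (Re_le_nr _) (cM k)).
have [b bP] := @ultra_real (fun k => Im (c k)) M
  (fun k => le_trans (Im_le_nr _) (cM k)).
exists (a +i* b) => e e0; have e2 : 0 < e / 2 by rewrite divr_gt0.
near=> k; apply: le_lt_trans (nr_le_ReIm _) _.
have : `|Re (c k) - a| < e / 2 by near: k; exact: aP.
have : `|Im (c k) - b| < e / 2 by near: k; exact: bP.
by case: (c k) => ck1 ck2 /=; lra.
Unshelve. all: by end_near. Qed.

(** Relative compactness of bounded sets in finite dimension: the Fourier coefficients are bounded,
    hence converge along [F]. *)
Lemma ultra_span (H : hilbertType R[i]) (e : nat -> H) m (x : nat -> H) (M : R) :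
  orthonormal_seq e -> (forall k, nr (x k) <= M) ->
  (\forall k \near F, in_span e m (x k)) ->
  exists l : H, forall d : R, 0 < d -> \forall k \near F, nr (x k - l) < d.
Proof.
move=> oe xM xm.
have /choice[c cP] : forall j, exists c : R[i], forall d : R, 0 < d ->
    \forall k \near F, nr (hdot (x k) (e j) - c) < d.
  by move=> j; apply: (@ultra_complex _ M) => k; apply: le_trans (xM k); exact: nr_hdot_le.
exists (\sum_(j < m) c j *: e j) => d d0.
pose E := 1 + \sum_(j < m) nr (e j).
have E0 : 0 < E by rewrite ltr_wpDr// sumr_ge0// => j _; exact: nr_ge0.
have dE : 0 < d / E by rewrite divr_gt0.
have cm : \forall k \near F, forall j : 'I_m, nr (hdot (x k) (e j) - c j) < d / E.
  by apply: filter_forall => j; exact: cP.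
near=> k.
have -> : x k - \sum_(j < m) c j *: e j =
    \sum_(j < m) (hdot (x k) (e j) - c j) *: e j.
  have {1}-> : x k = \sum_(j < m) hdot (x k) (e j) *: e j by near: k.
  by rewrite -sumrB; apply: eq_bigr => j _; rewrite scalerBl.
apply: le_lt_trans (nr_sum _) _.
apply: (@le_lt_trans _ _ (\sum_(j < m) (d / E * nr (e j)))).
  apply: ler_sum => j _; rewrite nrZ ler_wpM2r ?nr_ge0// ltW//.
  by move: j; near: k.
rewrite -mulr_sumr -[ltRHS](divfK (lt0r_neq0 E0)) ltr_pM2l//.
by rewrite /E ltrDr.
Unshelve. all: by end_near. Qed.

(* An ultrafilter finer than the Frechet filter extracts one subsequence that
   works for all the indices [j]. *)
Lemma ultra_subsequence (V : normedModType R[i]) (x : nat -> nat -> V)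
    (l : nat -> V) : \oo `<=` F ->
  (forall j (d : R), 0 < d -> \forall k \near F, nr (x k j - l j) < d) ->
  exists phi : nat -> nat, increasing_seq phi /\
    forall n j, (j <= n)%N -> nr (x (phi n) j - l j) < n.+1%:R^-1.
Proof.
move=> ooF xl.
have /choice[next nextP] : forall p : nat * nat, exists k, (p.2 < k)%N /\
    forall j, (j <= p.1)%N -> nr (x k j - l j) < p.1.+1%:R^-1.
  move=> -[n N] /=.
  have nF : \forall k \near F, forall j : 'I_n.+1, nr (x k j - l j) < n.+1%:R^-1.
    by apply: filter_forall => j; apply: xl; rewrite invr_gt0.
  have NF : \forall k \near F, (N < k)%N by apply: ooF; exists N.+1.
  have [k [Nk kn]] := filter_ex (filterI NF nF).
  by exists k; split=> // j jn; exact: (kn (Ordinal (jn : j < n.+1)%N)).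
pose phi := fix phi n := if n is m.+1 then next (n, phi m) else next (0%N, 0%N).
exists phi; split.
  apply/increasing_seqP => n; rewrite ltEnat /=.
  by have [] := nextP (n.+1, phi n).
by case=> [|n] j jn; [have [_] := nextP (0, 0)%N|have [_] := nextP (n.+1, phi n)];
  exact.
Qed.

End UltraLimits.

(** * A countable dense set of points *)

Lemma nr_rV_lt (R : realType) d (a : 'rV[R[i]]_d) (e : R) : 0 < e ->
  (forall j, nr (a 0 j) < e) -> nr a < e.
Proof.
move=> e0 ae; have [->|a0] := eqVneq a 0; first by rewrite nr0.
have [|[j k] /= jk] := @mx_norm_neq0 _ _ _ a.
  by rewrite -normr_eq0 in a0.
have -> : nr a = nr (a j k) by congr complex.Re.
by rewrite (ord1 j).
Qed.

Lemma dense_sequence (R : realType) d : exists D : nat -> 'rV[R[i]]_d,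
  forall a (e : R), 0 < e -> exists n, nr (D n - a) < e.
Proof.
pose f (q : 'rV[rat * rat]_d) : 'rV[R[i]]_d :=
  \row_j (ratr (q 0 j).1 +i* ratr (q 0 j).2).
(* Vectors with rational real and imaginary parts are countable; codes of no vector give 0. *)
exists (fun n => odflt 0 (omap f (unpickle n))) => a e e0.
have e2 : 0 < e / 2 by rewrite divr_gt0.
have /choice[q qP] : forall j, exists q : rat * rat,
    `|Re (a 0 j) - ratr q.1| < e / 2 /\ `|Im (a 0 j) - ratr q.2| < e / 2.
  move=> j.
  have near (t : R) : exists p : rat, `|t - ratr p| < e / 2.
    have /rat_in_itvoo[p] : t - e / 2 < t + e / 2 by lra.
    rewrite inE/= => /andP[]; rewrite !bnd_simp => p1 p2.
    by exists p; rewrite ltr_norml; apply/andP; split; lra.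
  by have [p ?] := near (Re (a 0 j)); have [p' ?] := near (Im (a 0 j)); exists (p, p').
exists (pickle (\row_j q j)); rewrite pickleK /=.
apply: nr_rV_lt => // j; rewrite !mxE.
apply: le_lt_trans (nr_le_ReIm _) _; have [+ +] := qP j.
by rewrite distrC (distrC (Im _)); case: (a 0 j) => a1 a2 /=; lra.
Qed.

(** * Convergence in the space of holomorphic functions *)

Section NormLimits.
Context {R : realType}.

Lemma cvg_nrP (V : normedModType R[i]) (s : nat -> V) l :
  s @ \oo --> l <-> forall e : R, 0 < e -> \forall n \near \oo, nr (s n - l) < e.
Proof.
split=> [sl e e0|sl A /nbhs_nrP[d d0 dA]].
  by apply: (sl [set y | nr (y - l) < e]); apply/nbhs_nrP; exists e.
by have := sl _ d0; apply: filterS => n; exact: dA.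
Qed.

Lemma cvg_nr_le (V : normedModType R[i]) (s : nat -> V) l (B : R) :
  s @ \oo --> l -> (\forall n \near \oo, nr (s n) <= B) -> nr l <= B.
Proof.
move=> /cvg_nrP sl sB; apply/ler_addgt0Pr => e e0.
have [n [sn sln]] := filter_ex (filterI sB (sl _ e0)).
by have := nr_lerB l (s n); rewrite nr_distC; lra.
Qed.

(** The Cauchy criterion with an approximate limit [a] for each [e]: below, [a] is a limit at a
    nearby point or a difference quotient. *)
Lemma cauchy_nr_cvg (V : completeNormedModType R[i]) (s : nat -> V) :
  (forall e : R, 0 < e -> exists a, \forall n \near \oo, nr (s n - a) < e) ->
  exists l : V, s @ \oo --> l.
Proof.
move=> sc; suff : cvgn s by move=> /cvg_ex[l sl]; exists l.
apply/cauchy_cvgP; apply: cauchy_exP => e e0.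
have eE : e = (Re e)%:C by rewrite RRe_real// ger0_real// ltW.
have [|a sa] := sc (Re e); first by rewrite -ltcR -eE.
exists a; apply: filterS sa => n; rewrite -ltcR -eE -nrE => sn.
by rewrite -ball_normE /= distrC.
Qed.

End NormLimits.

(** * Montel's argument for locally bounded holomorphic functions that converge at a dense set of
    points *)

Section Montel.
Context {R : realType} {d : nat} {H : hilbertType R[i]}.
Local Notation W := 'rV[R[i]]_d.
Context (Omega : set W) (w : nat -> W -> H).
Context (hw : forall n, holomorphic Omega (w n)).
Context (bw : locally_uniformly_bounded Omega w).
Context (dw : forall a, Omega a -> forall e : R, 0 < e -> exists2 b,
  nr (b - a) < e & exists l : H, w ^~ b @ \oo --> l).

Lemma bounded_on_ball a : Omega a -> exists r M, [/\ 0 < r, 0 <= M,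
  forall b, nr (b - a) <= r -> Omega b &
  forall n, bounded_holomorphic_on_ball (w n) a r M].
Proof.
move=> Oa; have [B [/nbhs_nrP[r r0 rB] BO [M wM]]] := bw Oa.
have M0 : 0 <= M.
  have Ba : B a by apply: rB; rewrite subrr nr0.
  by rewrite -ler0c (le_trans _ (wM 0%N a Ba)).
have ball_B b : nr (b - a) <= r / 2 -> B b by move=> ba; apply: rB; lra.
exists (r / 2), M; split => //; first by rewrite divr_gt0.
  by move=> b /ball_B/BO.
move=> n b /ball_B Bb; split; first exact/hw/BO.
by rewrite -lecR -nrE; exact: wM.
Qed.

Lemma equicontinuous a : Omega a -> exists r K, [/\ 0 < r, 0 <= K,
  forall b, nr (b - a) <= r -> Omega b &
  forall n b c, nr (b - a) <= r -> nr (c - a) <= r ->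
    nr (w n b - w n c) <= K * nr (b - c)].
Proof.
move=> Oa; have [r [M [r0 M0 rO wr]]] := bounded_on_ball Oa.
have r2 : 0 < r / 2 by rewrite divr_gt0.
(* Two points within [r / 64] of [a] differ by at most [r / 32 = r / 2 / 16], and the ball of radius
   [r / 2] around either lies in that of radius [r] around [a]. *)
exists (r / 64), (24 * M / (r / 2)); split; first by rewrite divr_gt0.
- by rewrite divr_ge0 ?(ltW r2)// mulr_ge0.
- by move=> b ba; apply: rO; lra.
move=> n b c ba ca.
have bE : b = c + (b - c) by rewrite addrC subrK.
rewrite {1}bE; apply: holomorphic_lipschitz => //.
  move=> x xc; apply: wr; have := nr_dist c x a; lra.
have := nr_dist a b c; rewrite (nr_distC a); lra.
Qed.

Lemma pointwise_limit : exists g : W -> H,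
  forall a, Omega a -> w ^~ a @ \oo --> g a.
Proof.
suff /choice[g gP] : forall a, exists l : H, Omega a -> w ^~ a @ \oo --> l.
  by exists g.
move=> a; have [Oa|nOa] := pselect (Omega a); last by exists 0.
suff [l wl] : exists l : H, w ^~ a @ \oo --> l by exists l.
apply: cauchy_nr_cvg => e e0.
have [r [K [r0 K0 _ wK]]] := equicontinuous Oa.
have K1 : 0 < K + 1 by rewrite ltr_wpDl.
(* Moving from [a] to [b] costs less than [e / 2], uniformly in [n]. *)
have [|b + [l /cvg_nrP wl]] := dw Oa (e := Num.min r (e / 2 / (K + 1))).
  by rewrite lt_min r0 !divr_gt0.
rewrite lt_min ltr_pdivlMr// => /andP[br be].
exists l; apply: filterS (wl _ (divr_gt0 e0 (ltr0n _ 2))) => n /= wn.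
have := nr_dist (w n b) (w n a) l.
have := wK n b a (ltW br); rewrite subrr nr0 => /(_ (ltW r0)).
rewrite (nr_distC (w n a) (w n b)); have := nr_ge0 (b - a); nra.
Qed.

Context (g : W -> H) (wg : forall a, Omega a -> w ^~ a @ \oo --> g a).

(** The limit inherits the Lipschitz constant, so three errors of [e / 3] suffice. The joint
    neighborhood in [b] and [n] is the form used by the near-covering form of compactness. *)
Lemma limit_locally_uniform a (e : R) : Omega a -> 0 < e ->
  \forall b \near a & n \near \oo, nr (g b - w n b) < e.
Proof.
move=> Oa e0; have [r [K [r0 K0 rO wK]]] := equicontinuous Oa.
have a0 : nr (a - a) <= r by rewrite subrr nr0 ltW.
have gK b : nr (b - a) <= r -> nr (g b - g a) <= K * nr (b - a).
  move=> ba; apply: (cvg_nr_le (s := fun n => w n b - w n a)).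
    by apply: cvgB; apply: wg => //; exact: rO.
  by apply: nearW => n; exact: wK.
have e3 : 0 < e / 3 by rewrite divr_gt0.
have K1 : 0 < K + 1 by rewrite ltr_wpDl.
have near_a : \forall b \near a, nr (b - a) < Num.min r (e / 3 / (K + 1)).
  apply/nbhs_nrP; exists (Num.min r (e / 3 / (K + 1))) => //.
  by rewrite lt_min r0 divr_gt0.
have near_oo : \forall n \near \oo, nr (w n a - g a) < e / 3.
  by move/cvg_nrP : (wg Oa); exact.
near=> b n.
have : nr (b - a) < Num.min r (e / 3 / (K + 1)) by near: b.
rewrite lt_min ltr_pdivlMr// => /andP[/ltW br be].
have wna : nr (w n a - g a) < e / 3 by near: n.
have := wK n b a br a0; have := gK b br; have := nr_ge0 (b - a).
have := nr_dist (g a) (g b) (w n b); have := nr_dist (w n a) (g a) (w n b).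
rewrite (nr_distC (g a) (w n a)) (nr_distC (w n a) (w n b)); nra.
Unshelve. all: by end_near. Qed.

Lemma limit_compact_cvg : {family compactly_in Omega, w @ \oo --> g}.
Proof.
apply/fam_cvgP => K [KO /compact_near_coveringP Kc] P /uniform_nbhs[E [entE EP]].
have [e e0 eE] : exists2 e : R, 0 < e & forall x y : H, nr (x - y) < e -> E (x, y).
  move: entE; rewrite -entourage_ballE => -[e /= e0 eE].
  have ee : e = (Re e)%:C by rewrite RRe_real// ger0_real// ltW.
  exists (Re e); first by rewrite -ltcR -ee.
  move=> x y xy; apply: (eE (x, y)); rewrite /= -ball_normE /=.
  by rewrite nrE ee ltcR.
have : \forall n \near \oo, K `<=` (fun b => nr (g b - w n b) < e).
  by apply: Kc => a /KO Oa; exact: limit_locally_uniform.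
by apply: filterS => n Kn; apply: EP => b /Kn; exact: eE.
Qed.

(** By Taylor's estimate, the difference quotient of [w n] at step [t] is within [C * t] of the
    derivative, uniformly in [n], and for fixed [t] it converges with [n]. *)
Lemma limit_derivative a : Omega a -> exists L : {linear W -> H},
  forall h, (fun n => 'd (w n) a h) @ \oo --> L h.
Proof.
move=> Oa; have [r [M [r0 M0 rO wr]]] := bounded_on_ball Oa.
have /choice[L LP] : forall h, exists l : H, (fun n => 'd (w n) a h) @ \oo --> l.
  move=> h; apply: cauchy_nr_cvg => e e0.
  pose C := 768 * M / r ^+ 2 * nr h ^+ 2.
  have C0 : 0 <= C by rewrite mulr_ge0 ?sqr_ge0// divr_ge0 ?sqr_ge0// mulr_ge0.
  (* The first bound keeps [t *: h] within [r / 16]; the second makes [C * t] less than [e / 2]. *)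
  pose t := Num.min (r / 16 / (nr h + 1)) (e / 2 / (C + 1)).
  have h1 : 0 < nr h + 1 by rewrite ltr_wpDl// nr_ge0.
  have C1 : 0 < C + 1 by rewrite ltr_wpDl.
  have t0 : 0 < t by rewrite lt_min !divr_gt0.
  have nt : nr (t%:C : R[i]) = t by rewrite nr_real gtr0_norm.
  have tC0 : (t%:C : R[i]) != 0 by rewrite -nr_gt0 nt.
  have tr : nr (t%:C *: h) <= r / 16.
    have : t * (nr h + 1) <= r / 16 by rewrite -ler_pdivlMr// ge_min lexx.
    by rewrite nrZ nt; nra.
  have te : t * (C + 1) <= e / 2 by rewrite -ler_pdivlMr// ge_min lexx orbT.
  have Oth : Omega (a + t%:C *: h) by apply: rO; rewrite addrC addKr; lra.
  exists (t%:C^-1 *: (g (a + t%:C *: h) - g a)).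
  have /cvg_nrP/(_ (t * (e / 2)))/(_ _)[|N _ NP] :
      (fun n => w n (a + t%:C *: h) - w n a) @ \oo --> g (a + t%:C *: h) - g a.
    by apply: cvgB; exact: wg.
    by rewrite mulr_gt0// divr_gt0.
  exists N => // n /NP /= wn.
  have := holomorphic_taylor r0 (wr n) tr.
  rewrite linearZ/= nrZ nt exprMn.
  set D := w n _ - w n a in wn *; set G := g _ - g a in wn *.
  set L := 'd _ _ _ => DL.
  have -> : L - t%:C^-1 *: G = t%:C^-1 *: ((D - G) - (D - t%:C *: L)).
    by module_coefs R[i]; field.
  rewrite nrZ nrV nt mulrC ltr_pdivrMr//.
  apply: le_lt_trans (nrB _ _) _.
  have -> : e * t = t * (e / 2) + t * (e / 2) by field.
  rewrite ltr_leD// (le_trans DL)// mulrCA -/C expr2 -mulrA ler_wpM2l ?(ltW t0)//.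
  by nra.
have Llin : linear L.
  move=> k x y; apply: (cvg_unique _ (LP (k *: x + y))) => //.
  have -> : (fun n => 'd (w n) a (k *: x + y)) =
      (fun n => k *: 'd (w n) a x + 'd (w n) a y).
    by apply/funext => n; rewrite linearP.
  by apply: cvgD; [apply: cvgZr; exact: LP|exact: LP].
by exists (HB.pack_for {linear W -> H} L (GRing.isLinear.Build R[i] W H *:%R L Llin)).
Qed.

(** The Lipschitz and Taylor estimates have constants independent of [n], so they pass to the
    limit. *)
Lemma limit_holomorphic : holomorphic Omega g.
Proof.
move=> a Oa; have [r [M [r0 M0 rO wr]]] := bounded_on_ball Oa.
have [L LP] := limit_derivative Oa.
have rO' h : nr h <= r / 16 -> Omega (a + h).
  by move=> hr; apply: rO; rewrite addrC addKr; lra.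
pose C := 768 * M / r ^+ 2.
have C0 : 0 <= C by rewrite divr_ge0 ?sqr_ge0// mulr_ge0.
have taylor h : nr h <= r / 16 -> nr (g (a + h) - g a - L h) <= C * nr h ^+ 2.
  move=> hr; apply: (cvg_nr_le (s := fun n => w n (a + h) - w n a - 'd (w n) a h)).
    by apply: cvgB; [apply: cvgB; apply: wg => //; exact: rO'|exact: LP].
  by apply: nearW => n; exact: holomorphic_taylor.
have lip h : nr h <= r / 16 -> nr (g (a + h) - g a) <= 24 * M / r * nr h.
  move=> hr; apply: (cvg_nr_le (s := fun n => w n (a + h) - w n a)).
    by apply: cvgB; apply: wg => //; exact: rO'.
  by apply: nearW => n; exact: holomorphic_lipschitz.
apply: (differentiable_nr (L := L)) => [|e e0].
  (* [L h] is [g (a + h) - g a] minus the Taylor remainder, and both are bounded for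
     [nr h <= r / 16]. *)
  apply: bounded_linear_continuous; apply/ex_bound.
  exists (24 * M / r * (r / 16) + C * (r / 16) ^+ 2)%:C.
  apply/nbhs_nrP; exists (r / 16) => [|h]; first by rewrite divr_gt0.
  rewrite subr0 => /ltW hr; rewrite /= nrE lecR.
  have := nrB (g (a + h) - g a) (g (a + h) - g a - L h); rewrite subKr.
  move=> /le_trans; apply; apply: lerD.
    rewrite (le_trans (lip _ hr))// ler_wpM2l// divr_ge0 ?(ltW r0)// mulr_ge0//.
  rewrite (le_trans (taylor _ hr))// ler_wpM2l// ler_pXn2r ?nnegrE ?nr_ge0//.
  by rewrite divr_ge0// ltW.
have C1 : 0 < C + 1 by rewrite ltr_wpDl.
exists (Num.min (r / 16) (e / (C + 1))) => [|h].
  by rewrite lt_min !divr_gt0.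
rewrite lt_min (ltr_pdivlMr _ _ C1) => /andP[/ltW hr he].
rewrite [h + a]addrC; apply: le_trans (taylor _ hr) _.
rewrite expr2 mulrA ler_wpM2r ?nr_ge0//; have := nr_ge0 h; nra.
Qed.

End Montel.

Lemma unitary_continuous (R : realType) (H : hilbertType R[i])
  (U : {linear H -> H}) : unitary U -> continuous U.
Proof.
move=> uU; apply: bounded_linear_continuous; apply/ex_bound; exists 1.
apply/nbhs_nrP; exists 1 => // h; rewrite subr0 /= nrE unitary_nr// => /ltW.
by rewrite -lecR.
Qed.

(** * Rotation, extraction of a subsequence and passage to the limit *)

Theorem theorem1p2 (R : realType) (d : nat) (H : hilbertType R[i])
    (Omega : set 'rV[R[i]]_d) (u : nat -> 'rV[R[i]]_d -> H) :
  open Omega ->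
  (forall k, holomorphic Omega (u k)) ->
  locally_uniformly_bounded Omega u ->
  exists U : nat -> {linear H -> H},
    (forall k, unitary (U k)) /\
    exists phi : nat -> nat, increasing_seq phi /\
      cvg_in_Hol Omega (fun j l => U (phi j) (u (phi j) l)).
Proof.
move=> oO hu bu; have [D Ddense] := dense_sequence R d.
have [e oe] := @orthonormal_seq_ex R H.
(* Outside of [Omega] the values of [u k] are arbitrary; 0 keeps every sequence bounded in [k]. *)
pose v k j : H := if `[< Omega (D j) >] then u k (D j) else 0.
have /choice[M vM] : forall j, exists M, forall k, nr (v k j) <= M.
  move=> j; rewrite /v; case: asboolP => [ODj|_]; last first.
    by exists 0 => _; rewrite nr0.
  have [B [/nbhs_singleton BD BO [M uM]]] := bu _ ODj.
  by exists M => k; rewrite -lecR -nrE; exact: uM.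
have /choice[U UP] := fun k => unitary_triangularization oe (v k) k.
have uU k : unitary (U k) by have [] := UP k.
have [F [FU ooF]] := ultraFilterLemma eventually_filter.
have /choice[l lP] : forall j, exists l : H, forall t : R, 0 < t ->
    \forall k \near F, nr (U k (v k j) - l) < t.
  move=> j; apply: (ultra_span (M := M j) (m := j.+1) oe).
    by move=> k; rewrite unitary_nr.
  (* [U k] triangularizes the vectors of index below [k], so [k > j] is required, which holds
     eventually. *)
  by apply: ooF; exists j.+1 => // k /= jk; have [_] := UP k; exact.
have [phi [phi_inc phiP]] := ultra_subsequence (x := fun k j => U k (v k j)) ooF lP.
exists U; split=> //; exists phi; split=> //.
set w := fun n l => U (phi n) (u (phi n) l).
have hw n : holomorphic Omega (w n).
  move=> a Oa; apply: differentiable_comp; first exact: hu.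
  by apply: linear_differentiable; exact: unitary_continuous.
have bw : locally_uniformly_bounded Omega w.
  move=> a /bu[B [aB BO [N uN]]]; exists B; split=> //; exists N => k m Bm.
  by rewrite nrE unitary_nr// -nrE; exact: uN.
have dw a : Omega a -> forall t : R, 0 < t -> exists2 b,
    nr (b - a) < t & exists l : H, w ^~ b @ \oo --> l.
  move=> Oa t t0; have /nbhs_nrP[r r0 rO] : nbhs a Omega by exact: open_nbhs_nbhs.
  have [|j] := Ddense a (Num.min r t); first by rewrite lt_min r0.
  rewrite lt_min => /andP[/rO ODj jt]; exists (D j) => //; exists (l j).
  apply/cvg_nrP => s s0; have [N Ns] : exists N, s^-1 < N%:R.
    by exists (Num.bound s^-1); rewrite archi_boundP// invr_ge0 ltW.
  (* Beyond [j] the bound [n.+1%:R^-1] applies to the index [j]; beyond [N] it is below [s]. *)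
  exists (maxn N j) => // n /=; rewrite geq_max => /andP[Nn jn].
  have := phiP n j jn; rewrite /v; case: asboolP => // _ /lt_trans; apply.
  rewrite -[ltRHS]invrK ltf_pV2 ?posrE ?invr_gt0// (lt_le_trans Ns)//.
  by rewrite ler_nat (leq_trans Nn).
have [g wg] := pointwise_limit hw bw dw.
by exists g; split; [exact: (limit_holomorphic hw bw wg)|exact: (limit_compact_cvg hw bw wg)].
Qed.
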